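(* Let $(\mathbb{K},|\cdot|)$ be either $\mathbb{R}$ with the usual absolute value or an arbitrary ultrametric field. Let $E$ be a metrizable (Hausdorff) topological $\mathbb{K}$-vector space and let $U\subseteq E$ be a non-empty open subset. Then: (a) the topology on $U$ induced by $E$ coincides with the final topology on $U$ with respect to the set of all smooth curves $c\colon\mathbb{K}\to E$ with image in $U$; (b) a map $f\colon U\to Z$ into a topological space $Z$ is continuous if and only if $f\circ c\colon\mathbb{K}\to Z$ is continuous for every smooth curve $c\colon\mathbb{K}\to E$ with image in $U$.
   Context: An ultrametric field is a field with a non-trivial absolute value satisfying $|x+y|\le\max\{|x|,|y|\}$. Smoothness of a curve $c\colon\mathbb{K}\to E$ is in the following sense: for open $V$ in a topological $\mathbb{K}$-vector space $X$, set $V^{[1]}:=\{(x,v,t)\in V\times X\times\mathbb{K}: x+tv\in V\}$. A map $g\colon V\to Y$ into a topological $\mathbb{K}$-vector space is $C^0$ if continuous, and $C^1$ if continuous and there is a continuous $g^{[1]}\colon V^{[1]}\to Y$ with $g(x+tv)-g(x)=t\,g^{[1]}(x,v,t)$ on $V^{[1]}$; recursively $V^{[k+1]}:=(V^{[k]})^{[1]}$, $g$ is $C^{k+1}$ if $C^k$ and $g^{[k]}$ is $C^1$, with $g^{[k+1]}:=(g^{[k]})^{[1]}$; smooth means $C^k$ for all $k$. Products carry the product topology; all vector spaces are Hausdorff. *)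

(* Defs.v *)
From mathcomp Require Import all_boot all_algebra.
From Stdlib Require Import Reals.
Set Implicit Arguments.
Unset Strict Implicit.
Unset Printing Implicit Defensive.
Import GRing.Theory.
Local Open Scope ring_scope.

Definition is_topology (T : Type) (op : (T -> Prop) -> Prop) : Prop :=
  op (fun _ => True) /\
  (forall F : (T -> Prop) -> Prop, (forall A, F A -> op A) ->
      op (fun x => exists A, F A /\ A x)) /\
  (forall A B, op A -> op B -> op (fun x => A x /\ B x)).

Definition prod_open (T1 T2 : Type) (op1 : (T1 -> Prop) -> Prop)
  (op2 : (T2 -> Prop) -> Prop) (O : T1 * T2 -> Prop) : Prop :=
  forall p, O p -> exists A B, op1 A /\ op2 B /\ A p.1 /\ B p.2 /\
     (forall q, A q.1 -> B q.2 -> O q).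

Definition cont_on (T1 T2 : Type) (op1 : (T1 -> Prop) -> Prop)
  (op2 : (T2 -> Prop) -> Prop) (V : T1 -> Prop) (f : T1 -> T2) : Prop :=
  forall x, V x -> forall W, op2 W -> W (f x) ->
    exists O, op1 O /\ O x /\ forall y, O y -> V y -> W (f y).

Definition continuous_map (T1 T2 : Type) (op1 : (T1 -> Prop) -> Prop)
  (op2 : (T2 -> Prop) -> Prop) (f : T1 -> T2) : Prop :=
  forall W, op2 W -> op1 (fun x => W (f x)).

Definition is_absval (K : fieldType) (abs : K -> R) : Prop :=
  (forall x, Rle R0 (abs x)) /\
  (forall x, abs x = R0 <-> x = 0) /\
  (forall x y, abs (x * y) = Rmult (abs x) (abs y)) /\
  (forall x y, Rle (abs (x + y)) (Rplus (abs x) (abs y))) /\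
  (exists x, abs x <> R0 /\ abs x <> R1).

Definition ultrametric (K : fieldType) (abs : K -> R) : Prop :=
  forall x y, Rle (abs (x + y)) (Rmax (abs x) (abs y)).

Definition is_usual_reals (K : fieldType) (abs : K -> R) : Prop :=
  exists phi : K -> R,
    (forall x y, phi (x + y) = Rplus (phi x) (phi y)) /\
    (forall x y, phi (x * y) = Rmult (phi x) (phi y)) /\
    phi 1 = R1 /\
    (forall r : R, exists! x : K, phi x = r) /\
    (forall x, abs x = Rabs (phi x)).

Definition admissible_field (K : fieldType) (abs : K -> R) : Prop :=
  is_absval abs /\ (is_usual_reals abs \/ ultrametric abs).

Definition openK (K : fieldType) (abs : K -> R) (A : K -> Prop) : Prop :=
  forall x, A x -> exists r, Rlt R0 r /\ forall y, Rlt (abs (y - x)) r -> A y.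

Definition metrizable (T : Type) (op : (T -> Prop) -> Prop) : Prop :=
  exists d : T -> T -> R,
    (forall x y, Rle R0 (d x y)) /\
    (forall x y, d x y = R0 <-> x = y) /\
    (forall x y, d x y = d y x) /\
    (forall x y z, Rle (d x z) (Rplus (d x y) (d y z))) /\
    (forall A, op A <-> forall x, A x -> exists r, Rlt R0 r /\
                                  forall y, Rlt (d x y) r -> A y).

(* Topological K-vector space (Hausdorffness is part of the hypotheses separately). *)
Definition is_tvs (K : fieldType) (abs : K -> R) (E : lmodType K)
  (opE : (E -> Prop) -> Prop) : Prop :=
  is_topology opE /\
  continuous_map (prod_open opE opE) opE (fun p : E * E => p.1 + p.2) /\
  continuous_map (prod_open (openK abs) opE) opE (fun p : K * E => p.1 *: p.2).

Definition hausdorff (T : Type) (op : (T -> Prop) -> Prop) : Prop :=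
  forall x y, x <> y -> exists A B, op A /\ op B /\ A x /\ B y /\
    forall z, A z -> B z -> False.

Definition V1 (K : fieldType) (X : lmodType K) (V : X -> Prop) : X * X * K^o -> Prop :=
  fun p => V p.1.1 /\ V (p.1.1 + p.2 *: p.1.2).

(* C^k in the sense of the paper: Ck k V g holds iff there is a chain
   g = g^[0], g^[1], ..., g^[k] with g^[j] continuous on V^[j] and
   g^[j+1] a difference quotient map for g^[j]. *)
Fixpoint Ck (K : fieldType) (abs : K -> R) (Y : lmodType K)
  (opY : (Y -> Prop) -> Prop) (k : nat) (X : lmodType K)
  (opX : (X -> Prop) -> Prop) (V : X -> Prop) (g : X -> Y) {struct k} : Prop :=
  cont_on opX opY V g /\
  match k with
  | 0 => True
  | k'.+1 => exists g1 : X * X * K^o -> Y,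
      (forall p, V1 V p -> g (p.1.1 + p.2 *: p.1.2) - g p.1.1 = p.2 *: g1 p) /\
      Ck abs opY k' (prod_open (prod_open opX opX) (openK abs : (K^o -> Prop) -> Prop))
         (V1 V) g1
  end.

Definition smooth_curve (K : fieldType) (abs : K -> R) (E : lmodType K)
  (opE : (E -> Prop) -> Prop) (c : K -> E) : Prop :=
  forall k, Ck abs opE k (X := K^o) (openK abs) (fun _ => True) c.

(* Main.v *)
Require Import Defs.
From Stdlib Require Import Reals Lra Classical ClassicalEpsilon.
From Coquelicot Require Import Coquelicot.
From mathcomp Require Import all_boot all_algebra.
Set Implicit Arguments.
Unset Strict Implicit.
Unset Printing Implicit Defensive.
Delimit Scope R_scope with Re.

(** Suppose that a set A that is open along all smooth curves is not a
    neighbourhood of x0 in A.  Points x_n outside A then exist arbitrarily close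
    to x0, and if x_n - x0 tends to 0 fast enough, the curve
    c(t) = x0 + sum_n h(rho^n t) (x_n - x0), with h a bump function supported in
    the shell 1/2 < |t| < 2 and |rho| >= 2, is smooth, stays in U and satisfies
    c(0) = x0 and c(rho^-n) = x_n, a contradiction.

    Smoothness is checked through divided differences: if c extends to a function
    D of finite lists of scalars with c(x) = D[x],
    D(l1,x',l2) - D(l1,x,l2) = (x'-x) D(l1,x',x,l2), and D is bounded on the
    lists of each given length, then D is continuous, and all the maps c^[k] are
    built from D by sums, products and substitutions.  Such a D for the bump h
    comes from Hadamard's integral formula applied to exp(-1/x) over the reals,
    and from Hermite interpolation of the indicator function of the ball
    |x - 1| < 1 over an ultrametric field. *)

(** * Real case: Hadamard quotients, divided differences and the flat function exp(-1/x) *)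

Section RealBump.
Local Open Scope R_scope.

(** All derivatives are carried along, each with a global bound, because this package survives the
    passage to [hadamard], where the bounds shift by one order. *)
Definition smooth_bounded_by (M : nat -> R) (f : R -> R) : Prop :=
  exists F : nat -> R -> R, (forall x, F 0%N x = f x) /\
    (forall k x, is_derive (F k) x (F k.+1 x)) /\
    (forall k x, Rabs (F k x) <= M k).

Lemma smooth_bounded_by_continuous M f x :
  smooth_bounded_by M f -> continuity_pt f x.
Proof.
move=> [F [F0 [dF _]]].
apply: (continuity_pt_ext (F 0%N)) => //.
apply/continuity_pt_filterlim; apply: ex_derive_continuous.
by exists (F 1%N x); apply: dF.
Qed.

(** Identities between [hadamard] quotients are field algebra away from the nodes; this carries them
    over to the nodes. *)
Lemma eq_continuous_dense (u v : R -> R) (y : R) :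
  continuity_pt u y -> continuity_pt v y ->
  (forall e, 0 < e -> exists2 z, Rabs (z - y) < e & u z = v z) ->
  u y = v y.
Proof.
move=> cu cv H; apply: cond_eq => e e0.
have e2 : 0 < e / 2 by lra.
have [d1 [d10 h1]] := cu _ e2.
have [d2 [d20 h2]] := cv _ e2.
have [z hz uv] := H _ (Rmin_pos _ _ d10 d20).
have H1 : Rabs (u z - u y) < e / 2.
  case: (Req_dec z y) => [->|ne]; first by rewrite Rminus_diag Rabs_R0.
  apply: h1; split; first by split=> //; apply: not_eq_sym.
  by apply: Rlt_le_trans hz (Rmin_l _ _).
have H2 : Rabs (v z - v y) < e / 2.
  case: (Req_dec z y) => [->|ne]; first by rewrite Rminus_diag Rabs_R0.
  apply: h2; split; first by split=> //; apply: not_eq_sym.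
  by apply: Rlt_le_trans hz (Rmin_r _ _).
rewrite uv in H1; move: H1 H2.
by split_Rabs; lra.
Qed.

(** The first divided difference of f at y and x, in an integral form that also makes sense for x =
    y, where it is f'(y). *)
Definition hadamard (y : R) (f : R -> R) (x : R) : R :=
  RInt (fun s => Derive f (y + s * (x - y))) 0 1.

(** Differentiation under the integral sign puts s^k and the derivative of f of order k+1 into the
    integrand, and s^k <= 1 on [0, 1]. *)
Lemma smooth_bounded_by_hadamard M f y :
  smooth_bounded_by M f -> smooth_bounded_by (fun k => M k.+1) (hadamard y f).
Proof.
move=> [F [F0 [dF bF]]].
have cF k x : continuous (F k) x.
  by apply: ex_derive_continuous; exists (F k.+1 x); apply: dF.
have cI k x s : continuous (fun s => s ^ k * F k.+1 (y + s * (x - y))) s.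
  apply: (continuous_mult (K := R_AbsRing)).
    by apply: ex_derive_continuous; auto_derive.
  apply: (continuous_comp (fun s => y + s * (x - y))); last exact: cF.
  by apply: ex_derive_continuous; auto_derive.
exists (fun k x => RInt (fun s => s ^ k * F k.+1 (y + s * (x - y))) 0 1).
split; [|split].
- move=> x; apply: RInt_ext => s _ /=; rewrite Rmult_1_l.
  rewrite (Derive_ext f (F 0%N)) => [|t]; last by rewrite F0.
  by rewrite (is_derive_unique _ _ _ (dF 0%N _)).
- move=> k x.
  have dI u s : is_derive (fun u => s ^ k * F k.+1 (y + s * (u - y))) u
      (s ^ k.+1 * F k.+2 (y + s * (u - y))).
    have -> : s ^ k.+1 * F k.+2 (y + s * (u - y)) =
       s ^ k * (s * F k.+2 (y + s * (u - y))) by rewrite /=; ring.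
    apply: is_derive_scal.
    apply: (is_derive_comp (F k.+1) (fun u => y + s * (u - y))); first exact: dF.
    by auto_derive => //; ring.
  have DI u s := is_derive_unique _ _ _ (dI u s).
  rewrite (RInt_ext _ (fun s => Derive (fun u => s ^ k * F k.+1 (y + s * (u - y))) x));
    last by move=> s _; rewrite DI.
  apply: (is_derive_RInt_param (fun u s => s ^ k * F k.+1 (y + s * (u - y)))).
  + by apply: filter_forall => u s _; exists (s ^ k.+1 * F k.+2 (y + s * (u - y))); apply: dI.
  + move=> s _.
    apply: (continuity_2d_pt_ext (fun u s => s ^ k.+1 * F k.+2 (y + s * (u - y)))).
      by move=> u t; rewrite DI.
    apply: continuity_2d_pt_mult.
      apply: (continuity_1d_2d_pt_comp (fun s => s ^ k.+1) (fun _ s => s)); last exact: continuity_2d_pt_id2.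
      by apply/continuity_pt_filterlim/ex_derive_continuous; auto_derive.
    apply: (continuity_1d_2d_pt_comp (F k.+2) (fun u s => y + s * (u - y))).
      by apply/continuity_pt_filterlim/cF.
    apply: continuity_2d_pt_plus; first exact: continuity_2d_pt_const.
    apply: continuity_2d_pt_mult; first exact: continuity_2d_pt_id2.
    apply: continuity_2d_pt_minus; [exact: continuity_2d_pt_id1|exact: continuity_2d_pt_const].
  + by apply: filter_forall => u; apply: ex_RInt_continuous => s _; apply: cI.
- move=> k x; have -> : M k.+1 = (1 - 0) * M k.+1 by ring.
  apply: abs_RInt_le_const; first lra.
    by apply: ex_RInt_continuous => s _; apply: cI.
  move=> s hs; rewrite Rabs_mult -RPow_abs (Rabs_pos_eq s); last lra.
  have h1 := pow_incr s 1 k hs; rewrite pow1 in h1.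
  rewrite -[M _]Rmult_1_l; apply: Rmult_le_compat => //; last exact: Rabs_pos.
  by apply: pow_le; lra.
Qed.

(** The substitution u = y + s(x - y), followed by the fundamental theorem of calculus. *)
Lemma hadamard_mul M f x y :
  smooth_bounded_by M f -> (x - y) * hadamard y f x = f x - f y.
Proof.
move=> [F [F0 [dF _]]].
have Df z : Derive f z = F 1%N z.
  by rewrite (Derive_ext f (F 0%N)) ?(is_derive_unique _ _ _ (dF 0%N _)).
have cF k z : continuous (F k) z.
  by apply: ex_derive_continuous; exists (F k.+1 z); apply: dF.
rewrite -[f x]F0 -[f y]F0.
have H : is_RInt (fun s => (x - y) * F 1%N ((x - y) * s + y)) 0 1 (F 0%N x - F 0%N y).
  apply: (is_RInt_comp_lin (F 1%N)).
  have -> : (x - y) * 0 + y = y by ring.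
  have -> : (x - y) * 1 + y = x by ring.
  by apply: (is_RInt_derive (F 0%N)) => z _; [apply: dF | apply: cF].
rewrite -(is_RInt_unique _ _ _ _ H).
apply: etrans (esym (RInt_scal (fun s => Derive f (y + s * (x - y))) 0 1 (x - y) _)) _.
  apply: ex_RInt_continuous => s _.
  apply: (continuous_ext (fun s => F 1%N (y + s * (x - y)))) => [t|]; first by rewrite Df.
  apply: (continuous_comp (fun s => y + s * (x - y))); last exact: cF.
  by apply: ex_derive_continuous; auto_derive.
apply: RInt_ext => s _; rewrite Df /scal /= /mult /=; congr (_ * F _ _); ring.
Qed.

Lemma hadamard_neq M f x y : smooth_bounded_by M f -> x <> y ->
  hadamard y f x = (f x - f y) / (x - y).
Proof.
move=> sf ne; rewrite -(hadamard_mul x y sf); field; lra.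
Qed.

(** Each of a and b can exclude only one of the three candidates y + e/2, y + e/3, y + e/4. *)
Lemma exists_near_avoid (a b y e : R) : 0 < e ->
  exists2 z, Rabs (z - y) < e & z <> a /\ z <> b /\ z <> y.
Proof.
move=> e0.
pose P z := z <> a /\ z <> b /\ z <> y.
have [//|H1] := excluded_middle_informative (P (y + e / 2)).
  by move=> P1; exists (y + e / 2) => //; split_Rabs; lra.
have [//|H2] := excluded_middle_informative (P (y + e / 3)).
  by move=> P1; exists (y + e / 3) => //; split_Rabs; lra.
exists (y + e / 4); first by split_Rabs; lra.
by move: H1 H2; rewrite /P; case: (Req_dec (y + e/2) a); case: (Req_dec (y + e/2) b);
 case: (Req_dec (y + e/3) a); case: (Req_dec (y + e/3) b) => ? ? ? ? H1 H2; try lra;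
 split; try lra; try (exfalso; apply H1; lra); try (exfalso; apply H2; lra).
Qed.

(** The relation f - g = a h is the form in which a change of one node is propagated through the
    nodes that follow it. *)
Lemma hadamard_linear M1 M2 M3 f g h a y z :
  smooth_bounded_by M1 f -> smooth_bounded_by M2 g -> smooth_bounded_by M3 h ->
  (forall x, f x - g x = a * h x) ->
  hadamard y f z - hadamard y g z = a * hadamard y h z.
Proof.
move=> sf sg sh E.
have cf := smooth_bounded_by_continuous z (smooth_bounded_by_hadamard y sf).
have cg := smooth_bounded_by_continuous z (smooth_bounded_by_hadamard y sg).
have ch := smooth_bounded_by_continuous z (smooth_bounded_by_hadamard y sh).
apply: (eq_continuous_dense (u := fun z => hadamard y f z - hadamard y g z)
   (v := fun z => a * hadamard y h z)).
- exact: continuity_pt_minus.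
- exact: continuity_pt_scal.
move=> e e0; have [t ht [ne _]] := exists_near_avoid y y z e0.
exists t => //; rewrite (hadamard_neq sf ne) (hadamard_neq sg ne) (hadamard_neq sh ne).
have -> : f t = g t + a * h t by rewrite -E; ring.
have -> : f y = g y + a * h y by rewrite -E; ring.
field; lra.
Qed.

(** The three-point recursion f[x',z] - f[x,z] = (x'-x) f[x',x,z]. For distinct x, x' and z off
    both, it is a field identity; continuity in z does the rest. *)
Lemma hadamard_hadamard M f x x' z : smooth_bounded_by M f ->
  hadamard x' f z - hadamard x f z = (x' - x) * hadamard x (hadamard x' f) z.
Proof.
move=> sf; have [->|nx] := Req_dec x' x; first by ring.
have sx' := smooth_bounded_by_hadamard x' sf.
apply: (eq_continuous_dense (u := fun z => hadamard x' f z - hadamard x f z)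
   (v := fun z => (x' - x) * hadamard x (hadamard x' f) z)).
- by apply: continuity_pt_minus; apply: smooth_bounded_by_continuous;
    apply: smooth_bounded_by_hadamard sf.
- by apply: continuity_pt_scal; apply: smooth_bounded_by_continuous;
    apply: smooth_bounded_by_hadamard sx'.
move=> e e0; have [t ht [ne [ne' _]]] := exists_near_avoid x x' z e0.
exists t => //; rewrite (hadamard_neq sx' ne) (hadamard_neq sf ne) (hadamard_neq sf ne').
rewrite (hadamard_neq sf (not_eq_sym nx)); field; lra.
Qed.

(** Nodes are divided out from the left: a node x replaces f by z |-> f[x,z], and the last node is
    the point of evaluation. The value on the empty list is a convention. *)
Fixpoint divdiff (f : R -> R) (l : seq R) : R :=
  match l with
  | [::] => 0
  | x :: l' => match l' with [::] => f x | _ :: _ => divdiff (hadamard x f) l' end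
  end.

Lemma divdiff_linear M1 M2 M3 f g h a l :
  smooth_bounded_by M1 f -> smooth_bounded_by M2 g -> smooth_bounded_by M3 h ->
  (forall x, f x - g x = a * h x) -> divdiff f l - divdiff g l = a * divdiff h l.
Proof.
elim: l M1 M2 M3 f g h => [|x [|y l] IH] M1 M2 M3 f g h sf sg sh E /=; first by ring.
  exact: E.
apply: (IH (fun k => M1 k.+1) (fun k => M2 k.+1) (fun k => M3 k.+1));
  try exact: smooth_bounded_by_hadamard.
by move=> z; apply: hadamard_linear sf sg sh E.
Qed.

(** Dividing out the nodes of l1 first reduces to l1 empty. Then [hadamard_mul] settles l2 empty,
    and otherwise [divdiff_linear] carries the three-point recursion through l2. *)
Lemma divdiff_sub M f x x' l1 l2 : smooth_bounded_by M f ->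
  divdiff f (l1 ++ x' :: l2) - divdiff f (l1 ++ x :: l2) =
  (x' - x) * divdiff f (l1 ++ x' :: x :: l2).
Proof.
elim: l1 M f => [|y l1 IH] M f sf; last first.
  have := IH _ _ (smooth_bounded_by_hadamard y sf).
  by case: l1 {IH}.
have s1 z := smooth_bounded_by_hadamard z sf.
case: l2 => [|y l2].
  by rewrite /= -(Ropp_minus_distr (f x)) -(hadamard_mul x x' sf); ring.
apply: (divdiff_linear (y :: l2) (s1 x') (s1 x) (smooth_bounded_by_hadamard x (s1 x'))).
by move=> z; apply: hadamard_hadamard sf.
Qed.

Lemma divdiff_bound M f l : smooth_bounded_by M f -> (0 < size l)%N ->
  Rabs (divdiff f l) <= M (size l).-1.
Proof.
elim: l M f => [//|x [|y l] IH] M f sf _ /=.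
  by case: sf => F [F0 [_ bF]]; rewrite -F0.
exact: (IH _ _ (smooth_bounded_by_hadamard x sf)).
Qed.

(** For a node x outside (a, b), [hadamard x f] again vanishes outside (a, b): away from x it is a
    quotient with zero numerator, and at x continuity applies, since x is a limit of other points
    outside (a, b). *)
Lemma divdiff_eq0 M f (a b : R) l : smooth_bounded_by M f -> a < b ->
  (forall x, x <= a \/ b <= x -> f x = 0) ->
  (forall x, List.In x l -> x <= a \/ b <= x) -> divdiff f l = 0.
Proof.
move=> sf ab; elim: l M f sf => [//|x [|y l] IH] M f sf f0 lP.
  by apply: f0; apply: lP; left.
have sx := smooth_bounded_by_hadamard x sf.
apply: (IH _ _ sx) => [z Sz|z zl]; last by apply: lP; right.
have Sx : x <= a \/ b <= x by apply: lP; left.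
apply: (eq_continuous_dense (v := fun _ => 0)).
- exact: smooth_bounded_by_continuous sx.
- by apply: continuity_pt_const.
have nz t : t <= a \/ b <= t -> t <> x -> hadamard x f t = 0.
  by move=> St ne; rewrite (hadamard_neq sf ne) !f0 //; field; lra.
move=> e e0; case: (Req_dec z x) => [->|ne]; last first.
  by exists z; [rewrite Rminus_diag Rabs_R0|apply: nz].
by case: Sx => Sx; [exists (x - e / 2)|exists (x + e / 2)];
  rewrite ?nz //; try lra; split_Rabs; lra.
Qed.

(** The powers of 1/x make the span of the family closed under differentiation; j = 0 is the
    classical flat function. *)
Definition flat (j : nat) (x : R) : R :=
  if Rlt_dec 0 x then (/ x) ^ j * exp (- / x) else 0.

(** With w = 1/x, a single term of the exponential series gives w^j / j! <= exp w, so j! is a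
    bound. *)
Lemma flat_bounded j : exists M, forall x, Rabs (flat j x) <= M.
Proof.
exists (INR (Factorial.fact j)) => x; rewrite /flat.
have f0 := INR_fact_lt_0 j.
case: Rlt_dec => x0; last by rewrite Rabs_R0; lra.
have w0 := Rinv_0_lt_compat _ x0.
have p0 := pow_lt _ j w0.
rewrite Rabs_pos_eq; last by apply: Rmult_le_pos; [lra|apply/Rlt_le/exp_pos].
have H := exp_ge_taylor (/ x) j (Rlt_le _ _ w0).
have H2 : (/ x) ^ j / INR (Factorial.fact j) <= exp (/ x).
  apply: Rle_trans H; case: j f0 p0 => [|j] f0 p0; first by rewrite /=; lra.
  rewrite tech5 -[X in X <= _]Rplus_0_l; apply: Rplus_le_compat_r.
  apply: cond_pos_sum => k; apply: Rmult_le_pos.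
    by apply: pow_le; lra.
  by apply/Rlt_le/Rinv_0_lt_compat/INR_fact_lt_0.
rewrite exp_Ropp; apply: (Rmult_le_reg_r (exp (/ x))); first exact: exp_pos.
rewrite Rmult_assoc Rinv_l; last by have := exp_pos (/ x); lra.
rewrite Rmult_1_r; have := Rmult_le_compat_l _ _ _ (Rlt_le _ _ f0) H2.
by have -> : INR (Factorial.fact j) * ((/ x) ^ j / INR (Factorial.fact j)) = (/ x) ^ j by field; lra.
Qed.

Lemma flatS j x : x * flat j.+1 x = flat j x.
Proof. by rewrite /flat; case: Rlt_dec => h /=; field; lra. Qed.

(** At 0 one has [flat j h = h * (h * flat j.+2 h)] with a bounded last factor, so the difference
    quotient is O(h). Elsewhere [flat j] is locally elementary. *)
Lemma is_derive_flat j x :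
  is_derive (flat j) x (flat j.+2 x - INR j * flat j.+1 x).
Proof.
have [x0|[x0|x0]] := Rtotal_order x 0.
- have f0 k : flat k x = 0 by rewrite /flat; case: Rlt_dec => // ?; lra.
  rewrite !f0; apply: (is_derive_ext_loc (fun _ => 0)); last first.
    by rewrite Rmult_0_r Rminus_diag; apply: is_derive_const.
  apply: (filter_imp (fun y => y < 0)); last exact: open_lt.
  by move=> y y0; rewrite /flat; case: Rlt_dec => // ?; lra.
- have [M bM] := flat_bounded j.+2; rewrite x0.
  have f0 k : flat k 0 = 0 by rewrite /flat; case: Rlt_dec => // ?; lra.
  rewrite !f0 Rmult_0_r Rminus_diag; apply/is_derive_Reals => e e0.
  have M0 : 0 <= M by apply: Rle_trans (bM 0); apply: Rabs_pos.
  have d0 : 0 < e / (M + 1) by apply: Rdiv_lt_0_compat; lra.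
  exists (mkposreal _ d0) => h h0 /= hd.
  rewrite Rplus_0_l f0 -(flatS j h) -(flatS j.+1 h).
  have -> : (h * (h * flat j.+2 h) - 0) / h - 0 = h * flat j.+2 h by field.
  rewrite Rabs_mult; apply: (Rle_lt_trans _ (Rabs h * (M + 1))).
    by apply: Rmult_le_compat_l; [apply: Rabs_pos|have := bM h; lra].
  apply: (Rlt_le_trans _ (e / (M + 1) * (M + 1))).
    by apply: Rmult_lt_compat_r => //; lra.
  by apply: Req_le; field; lra.
apply: (is_derive_ext_loc (fun x => (/ x) ^ j * exp (- / x))).
  apply: (filter_imp (fun y => 0 < y)); last exact: open_gt.
  by move=> y y0; rewrite /flat; case: Rlt_dec.
have fE k : flat k x = (/ x) ^ k * exp (- / x) by rewrite /flat; case: Rlt_dec.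
rewrite !fE; auto_derive; first lra.
case: j => [|j]; rewrite ?S_INR /=; field; lra.
Qed.

(** Functions supported in [1/2, 3/2]. Each is bounded and the family is closed under
    differentiation, so all derivatives of a member are bounded. *)
Inductive flat_span : (R -> R) -> Prop :=
| flat_span_mul j k : flat_span (fun x => flat j (x - 1/2) * flat k (3/2 - x))
| flat_span_add f g : flat_span f -> flat_span g -> flat_span (fun x => f x + g x)
| flat_span_scale a f : flat_span f -> flat_span (fun x => a * f x).

Lemma flat_span_bounded f : flat_span f -> exists M, forall x, Rabs (f x) <= M.
Proof.
elim=> [j k|g h _ [M bM] _ [N bN]|a g _ [M bM]].
- have [M bM] := flat_bounded j; have [N bN] := flat_bounded k.
  exists (M * N) => x; rewrite Rabs_mult.
  by apply: Rmult_le_compat => //; apply: Rabs_pos.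
- exists (M + N) => x; apply: Rle_trans (Rabs_triang _ _) _.
  by apply: Rplus_le_compat.
- exists (Rabs a * M) => x; rewrite Rabs_mult.
  by apply: Rmult_le_compat_l => //; apply: Rabs_pos.
Qed.

Lemma flat_span_derive f : flat_span f ->
  exists g, flat_span g /\ forall x, is_derive f x (g x).
Proof.
elim=> [j k|g h _ [g' [Sg dg]] _ [h' [Sh dh]]|a g _ [g' [Sg dg]]].
- pose F i m x := flat i (x - 1/2) * flat m (3/2 - x).
  exists (fun x => (F j.+2 k x + - INR j * F j.+1 k x)
              + (- 1 * F j k.+2 x + INR k * F j k.+1 x)); split.
    by do !(apply: flat_span_add || apply: flat_span_scale || apply: flat_span_mul).
  move=> x.
  have -> : F j.+2 k x + - INR j * F j.+1 k x + (-1 * F j k.+2 x + INR k * F j k.+1 x)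
    = (flat j.+2 (x - 1/2) - INR j * flat j.+1 (x - 1/2)) * flat k (3/2 - x)
      + flat j (x - 1/2) * (- (flat k.+2 (3/2 - x) - INR k * flat k.+1 (3/2 - x))).
    by rewrite /F; ring.
  apply: (is_derive_mult (fun x => flat j (x - 1/2)) (fun x => flat k (3/2 - x)));
    last exact: Rmult_comm.
    rewrite -[X in is_derive _ _ X]Rmult_1_l.
    apply: (is_derive_comp (flat j) (fun x => x - 1/2)); first exact: is_derive_flat.
    by auto_derive => //; ring.
  have -> : - (flat k.+2 (3/2 - x) - INR k * flat k.+1 (3/2 - x)) =
    -1 * (flat k.+2 (3/2 - x) - INR k * flat k.+1 (3/2 - x)) by ring.
  apply: (is_derive_comp (flat k) (fun x => 3/2 - x)); first exact: is_derive_flat.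
  by auto_derive => //; ring.
- exists (fun x => g' x + h' x); split; first exact: flat_span_add.
  by move=> x; apply: (is_derive_plus g h).
- exists (fun x => a * g' x); split; first exact: flat_span_scale.
  by move=> x; apply: is_derive_scal.
Qed.

Lemma flat_span_smooth f : flat_span f -> exists M, smooth_bounded_by M f.
Proof.
move=> Sf.
have H (g : {g | flat_span g}) :
    {g' : {g | flat_span g} | forall x, is_derive (sval g) x (sval g' x)}.
  apply: constructive_indefinite_description.
  case: g => g Sg; have [g' [Sg' dg]] := flat_span_derive Sg.
  by exists (exist _ g' Sg').
pose F k := sval (iter k (fun g => sval (H g)) (exist _ f Sf)).
have B k : {M | forall x, Rabs (F k x) <= M}.
  apply: constructive_indefinite_description.
  by rewrite /F; case: (iter _ _ _) => g Sg; apply: flat_span_bounded.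
exists (fun k => sval (B k)), F; split=> //; split.
  by move=> k x; rewrite /F iterS; case: (H _).
by move=> k; case: (B k).
Qed.

Lemma real_bump : exists D : seq R -> R, D [:: 1] = 1 /\
  (forall l1 x' x l2, D (l1 ++ x' :: l2) - D (l1 ++ x :: l2) =
     (x' - x) * D (l1 ++ x' :: x :: l2)) /\
  (exists B : nat -> R, forall l, (0 < size l)%N -> Rabs (D l) <= B (size l)) /\
  (forall l, (forall x, List.In x l -> Rabs x <= 1/2 \/ 2 <= Rabs x) -> D l = 0).
Proof.
(* At x = 1 both flat factors equal exp(-2), so exp 4 normalizes the value to 1. *)
pose f x := exp 4 * (flat 0 (x - 1/2) * flat 0 (3/2 - x)).
have [M sM] : exists M, smooth_bounded_by M f.
  by apply/flat_span_smooth/flat_span_scale/flat_span_mul.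
exists (divdiff f); split; [|split; [|split]].
- rewrite /= /f /flat /=; do 2![case: Rlt_dec => ?; last lra].
  rewrite !Rmult_1_l -!exp_plus -[RHS]exp_0; congr exp; field.
- by move=> l1 x' x l2; apply: divdiff_sub sM.
- by exists (fun m => M m.-1) => l l0; apply: divdiff_bound.
- move=> l lP; apply: (divdiff_eq0 (a := 1/2) (b := 3/2) sM); first lra.
    move=> x Sx; rewrite /f /flat; do 2![case: Rlt_dec => ? /=]; lra.
  by move=> x /lP; split_Rabs; lra.
Qed.
End RealBump.

(** * Absolute values and the bump over an admissible field *)

Section AbsoluteValue.
Import GRing.Theory.
Local Open Scope ring_scope.
Variables (K : fieldType) (abs : K -> R).
Hypothesis absP : is_absval abs.

Lemma abs_ge0 x : (0 <= abs x)%Re.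
Proof. by case: absP. Qed.

Lemma abs_eq0 x : abs x = 0%Re <-> x = 0.
Proof. by case: absP => _ []. Qed.

Lemma abs0 : abs 0 = 0%Re.
Proof. by apply/abs_eq0. Qed.

Lemma absM x y : abs (x * y) = (abs x * abs y)%Re.
Proof. by case: absP => _ [_ []]. Qed.

Lemma absD x y : (abs (x + y) <= abs x + abs y)%Re.
Proof. by case: absP => _ [_ [_ []]]. Qed.

Lemma abs_gt0 x : x != 0 -> (0 < abs x)%Re.
Proof.
move=> x0; case: (Rle_lt_or_eq_dec _ _ (abs_ge0 x)) => // /esym /abs_eq0 e.
by rewrite e eqxx in x0.
Qed.

Lemma abs1 : abs 1 = 1%Re.
Proof.
have h : (0 < abs 1)%Re by apply: abs_gt0; apply: oner_neq0.
by have := absM 1 1; rewrite mulr1; nra.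
Qed.

Lemma absN x : abs (- x) = abs x.
Proof.
have h : abs (-1) = 1%Re.
  have := absM (-1) (-1); rewrite mulrNN mulr1 abs1 => e.
  have := abs_ge0 (-1); nra.
by rewrite -mulN1r absM h Rmult_1_l.
Qed.

Lemma absB x y : abs (x - y) = abs (y - x).
Proof. by rewrite -absN opprB. Qed.

Lemma absV x : x != 0 -> abs x^-1 = (/ abs x)%Re.
Proof.
move=> x0; have h := abs_gt0 x0.
apply: (Rmult_eq_reg_l (abs x)); last lra.
by rewrite -absM divff // abs1 Rinv_r //; lra.
Qed.

Lemma absX x n : abs (x ^+ n) = (abs x ^ n)%Re.
Proof. by elim: n => [|n IH]; rewrite ?expr0 ?abs1 // exprS absM IH. Qed.

Lemma exists_abs_ge2 : exists x, (2 <= abs x)%Re.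
Proof.
have [x x1] : exists x, (1 < abs x)%Re.
  case: absP => _ [_ [_ [_ [x [x0 x1]]]]].
  case: (Rlt_le_dec 1 (abs x)) => h; first by exists x.
  have nx : x != 0 by apply/eqP => /abs_eq0.
  exists x^-1; rewrite absV // -Rinv_1; apply: Rinv_lt_contravar.
    by have := abs_gt0 nx; lra.
  by have := abs_gt0 nx; lra.
have x1' : (Rabs (abs x) > 1)%Re by rewrite Rabs_pos_eq //; lra.
have [N hN] := Pow_x_infinity _ x1' 2%Re.
exists (x ^+ N); rewrite absX.
by have := hN N (le_n N); rewrite Rabs_pos_eq; [lra|apply: pow_le; lra].
Qed.

Definition divided_differences (E : lmodType K) (D : seq K -> E) : Prop :=
  forall l1 x' x l2,
    D (l1 ++ x' :: l2) - D (l1 ++ x :: l2) = (x' - x) *: D (l1 ++ x' :: x :: l2).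

(* The divided differences D of a function that is 1 at 1 and vanishes
   outside the shell 1/2 < |x| < 2. *)
Definition bump (D : seq K -> K^o) : Prop :=
  D [:: 1] = 1 /\ divided_differences D /\
  (exists B : nat -> R, forall l, (0 < size l)%N -> (abs (D l) <= B (size l))%Re) /\
  (forall l, (forall x, x \in l -> (abs x <= 1/2)%Re \/ (2 <= abs x)%Re) -> D l = 0).

(** The inverse [psi] of phi carries the real divided differences to K; identities are checked after
    applying the injective phi. *)
Lemma usual_reals_bump : is_usual_reals abs -> exists D, bump D.
Proof.
move=> [phi [phiD [phiM [phi1 [phi_bij absE]]]]].
have phiV r : {x | phi x = r}.
  apply: constructive_indefinite_description.
  by have [x [hx _]] := phi_bij r; exists x.
have phi_inj x y : phi x = phi y -> x = y.
  move=> e; have [z [_ hz]] := phi_bij (phi x).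
  by rewrite -(hz x erefl) -(hz y (esym e)).
pose psi r := sval (phiV r).
have psiK r : phi (psi r) = r by rewrite /psi; case: (phiV r).
have phi0 : phi 0 = 0%Re by have := phiD 0 0; rewrite addr0; lra.
have phiB x y : phi (x - y) = (phi x - phi y)%Re.
  by have := phiD (x - y) y; rewrite subrK; lra.
have [D [D1 [Dd [[B DB] D0]]]] := real_bump.
exists (fun l => psi (D (map phi l))); split; [|split; [|split]].
- by apply: phi_inj; rewrite psiK /= phi1 D1.
- move=> l1 x' x l2; apply: phi_inj.
  by rewrite phiB phiM phiB !psiK !map_cat /= Dd.
- by exists B => l l0; rewrite absE psiK -(size_map phi); apply: DB; rewrite size_map.
- move=> l lP; apply: phi_inj; rewrite psiK phi0; apply: D0.
  move=> r; elim: l lP => [//|x l IH] lP /= [<-|]; last first.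
    by apply: IH => y yl; apply: lP; rewrite inE yl orbT.
  by rewrite -absE; apply: lP; rewrite inE eqxx.
Qed.

(** * Ultrametric case: divided differences by Hermite interpolation *)

Section Ultrametric.
Hypothesis absU : ultrametric abs.

Let inb (x : K) : bool := if Rlt_dec (abs (x - 1)) 1 then true else false.

Let inbP x : reflect (abs (x - 1) < 1)%Re (inb x).
Proof. by rewrite /inb; case: Rlt_dec => h; constructor. Qed.

(* p is the Hermite interpolant at l of the indicator of the ball |x - 1| < 1. *)
Definition interpolant (l : seq K) (p : {poly K}) : Prop :=
  (size p <= size l)%N /\
  (\prod_(x <- l | inb x) ('X - x%:P) %| p - 1) /\
  (\prod_(x <- l | ~~ inb x) ('X - x%:P) %| p).

Lemma interpolant_coprime (l : seq K) :
  coprimep (\prod_(x <- l | inb x) ('X - x%:P)) (\prod_(x <- l | ~~ inb x) ('X - x%:P)).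
Proof.
rewrite -!(big_filter l).
elim: (filter _ l) (filter_all inb l) => [|x s IH] /=; first by rewrite big_nil coprime1p.
case/andP=> xin sin; rewrite big_cons coprimepMl IH // andbT.
elim: (filter _ l) (filter_all (fun x => ~~ inb x) l) => [|y t IHt] /=.
  by rewrite big_nil coprimep1.
case/andP=> yout tout; rewrite big_cons coprimepMr IHt // andbT.
rewrite coprimep_XsubC root_XsubC; apply: contra yout => /eqP e.
by rewrite ?e // -?e.
Qed.

Lemma prod_in_out (l : seq K) :
  \prod_(x <- l) ('X - x%:P) =
  \prod_(x <- l | inb x) ('X - x%:P) * \prod_(x <- l | ~~ inb x) ('X - x%:P).
Proof. by rewrite (bigID inb). Qed.

Lemma interpolant_exists l : exists p, interpolant l p.
Proof.
have /Bezout_eq1_coprimepP [[u v] /= uv] := interpolant_coprime l.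
set a := \prod_(x <- l | inb x) _ in uv; set b := \prod_(x <- l | ~~ inb x) _ in uv.
have ab : \prod_(x <- l) ('X - x%:P) = a * b by apply: prod_in_out.
have re : (v * b) %% (a * b) = v * b - (v * b) %/ (a * b) * (a * b).
  by rewrite {2}[v * b](divp_eq _ (a * b)) addrC addKr.
(* Chinese remainders: by u a + v b = 1, the product v b is 1 modulo a and 0 modulo b; reduction
   modulo a b keeps this and bounds the degree. *)
exists ((v * b) %% (a * b)); split; [|split].
- by rewrite -ltnS -(size_prod_XsubC l id) ab ltn_modp -ab -size_poly_eq0 size_prod_XsubC.
- have -> : (v * b) %% (a * b) - 1 = - ((v * b) %/ (a * b) * (a * b)) - u * a.
    by rewrite re -uv opprD [- (u * a) - _]addrC addrACA subrr add0r.
  by rewrite -/a dvdp_sub // ?dvdpNr dvdp_mull // dvdp_mulr.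
- by rewrite re -/b dvdp_sub ?dvdp_mull.
Qed.

(** The difference is divisible by both coprime node products, hence by a polynomial of degree
    [size l], which its size does not allow unless it is zero. *)
Lemma interpolant_unique l p q : interpolant l p -> interpolant l q -> p = q.
Proof.
move=> [sp [p1 p0]] [sq [q1 q0]]; apply/eqP; rewrite -subr_eq0.
have : \prod_(x <- l) ('X - x%:P) %| p - q.
  rewrite prod_in_out Gauss_dvdp ?interpolant_coprime //.
  apply/andP; split; last exact: dvdp_sub.
  have -> : p - q = (p - 1) - (q - 1) by rewrite opprB addrA subrK.
  by rewrite dvdp_sub.
apply: contraTT => /dvdp_leq H; apply/negP => /H.
rewrite size_prod_XsubC leqNgt ltnS => /negP; apply.
by apply: leq_trans (size_polyD _ _) _; rewrite size_polyN geq_max sp sq.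
Qed.

Definition hermite (l : seq K) : {poly K} :=
  sval (constructive_indefinite_description _ (interpolant_exists l)).

Lemma hermiteP l : interpolant l (hermite l).
Proof. by rewrite /hermite; case: constructive_indefinite_description. Qed.

Lemma hermiteE l p : interpolant l p -> hermite l = p.
Proof. by apply: interpolant_unique; apply: hermiteP. Qed.

Lemma perm_hermite l l' : perm_eq l l' -> hermite l = hermite l'.
Proof.
move=> e; apply: hermiteE; have [h1 [h2 h3]] := hermiteP l'.
by split; [rewrite (perm_size e)|rewrite !(perm_big _ e)].
Qed.

(** A divided difference is the highest admissible coefficient of the interpolant. This makes sense
    for repeated nodes and is symmetric in the nodes. *)
Definition ball_divdiff (l : seq K) : K^o := (hermite l)`_(size l).-1.

Lemma perm_ball_divdiff l l' : perm_eq l l' -> ball_divdiff l = ball_divdiff l'.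
Proof. by move=> e; rewrite /ball_divdiff (perm_hermite e) (perm_size e). Qed.

(** Newton's interpolation formula: subtracting the top coefficient times the monic node polynomial
    lowers the degree and changes nothing modulo the remaining nodes. *)
Lemma hermite_cons y z l : hermite (z :: l) =
  hermite (y :: z :: l) - ball_divdiff (y :: z :: l) *: \prod_(x <- z :: l) ('X - x%:P).
Proof.
apply: hermiteE; have [sq [q1 q0]] := hermiteP (y :: z :: l).
set q := hermite _ in sq q1 q0 *; set a := ball_divdiff _.
have dv (P : pred K) : \prod_(x <- z :: l | P x) ('X - x%:P) %|
    \prod_(x <- y :: z :: l | P x) ('X - x%:P).
  by rewrite (big_cons _ _ y); case: (P y) => //; rewrite dvdp_mull.
have dv2 (P : pred K) : \prod_(x <- z :: l | P x) ('X - x%:P) %|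
    a *: \prod_(x <- z :: l) ('X - x%:P).
  by rewrite -mul_polyC; apply: dvdp_mull; rewrite [X in _ %| X](bigID P) /= dvdp_mulr.
split; [|split].
- apply/leq_sizeP => j; rewrite leq_eqVlt coefB coefZ => /orP [/eqP <-|hj].
    have /monicP := monic_prod_XsubC (z :: l) xpredT id.
    rewrite lead_coefE size_prod_XsubC /= => ->.
    by rewrite mulr1 subrr.
  rewrite !nth_default ?mulr0 ?subr0 //; first by rewrite size_prod_XsubC.
  exact: leq_trans sq _.
- by rewrite addrAC dvdp_sub // (dvdp_trans (dv _) q1).
- by rewrite dvdp_sub // (dvdp_trans (dv _) q0).
Qed.

(** Both interpolants on the left come from the one at x', x and l by Newton's formula. The
    coefficients of that interpolant cancel, and those of the two node polynomials differ by x' -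
    x. *)
Lemma ball_divdiff_cons x' x l :
  ball_divdiff (x' :: l) - ball_divdiff (x :: l) = (x' - x) *: ball_divdiff (x' :: x :: l).
Proof.
have e : perm_eq [:: x, x' & l] [:: x', x & l].
  by rewrite (perm_catCA [:: x] [:: x'] l).
rewrite {1 2}/ball_divdiff (hermite_cons x x' l) (hermite_cons x' x l).
rewrite (perm_hermite e) (perm_ball_divdiff e) /=.
set q := hermite _; set a := ball_divdiff _.
have c y : (\prod_(z <- y :: l) ('X - z%:P))`_(size l) =
    ('X * \prod_(z <- l) ('X - z%:P))`_(size l) - y.
  rewrite big_cons mulrBl coefB coefCM.
  have /monicP := monic_prod_XsubC l xpredT id.
  by rewrite lead_coefE size_prod_XsubC /= => ->; rewrite mulr1.
rewrite !coefB !coefZ !c; set u := _`_(size l); set w := _`_(size l).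
rewrite opprB addrC addrA subrK -mulrBr mulrC /GRing.scale /=; congr (_ * _).
by rewrite opprB addrC addrA subrK.
Qed.

Lemma ball_divdiff_divided_differences : divided_differences ball_divdiff.
Proof.
move=> l1 x' x l2.
have m s t : perm_eq (l1 ++ s :: t) (s :: l1 ++ t) by rewrite perm_catC /= perm_cons perm_catC.
have e : perm_eq (l1 ++ [:: x', x & l2]) [:: x', x & l1 ++ l2].
  by rewrite (perm_trans (m _ _)) // perm_cons.
by rewrite !(perm_ball_divdiff (m _ l2)) (perm_ball_divdiff e) ball_divdiff_cons.
Qed.

Lemma ball_divdiff_out l : (forall x, x \in l -> ~~ inb x) -> ball_divdiff l = 0.
Proof.
move=> h; rewrite /ball_divdiff (_ : hermite l = 0) ?coef0 //.
apply: hermiteE; split; [|split]; rewrite ?size_poly0 ?dvdp0 //.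
by rewrite big_seq_cond big_pred0 ?dvd1p // => x; apply/negP => /andP [/h /negP].
Qed.

Lemma ball_divdiff_in l : (0 < size l)%N -> (forall x, x \in l -> inb x) ->
  ball_divdiff l = ((size l == 1)%N)%:R.
Proof.
move=> l0 h; rewrite /ball_divdiff (_ : hermite l = 1) ?coef1 //.
  by case: (size l) l0 => [|[|n]].
apply: hermiteE; split; [|split]; rewrite ?size_poly1 ?subrr ?dvdp0 //.
by rewrite big_seq_cond big_pred0 // => x; apply/negP => /andP [/h ->].
Qed.

(** If all nodes lie in the ball, or all outside, the value is 0 or 1. Otherwise the recursion is
    applied to x in the ball and y outside: |x - y| >= 1, so division by x - y preserves the bound 1
    of the shorter lists. *)
Lemma ball_divdiff_bound l : (0 < size l)%N -> (abs (ball_divdiff l) <= 1)%Re.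
Proof.
move: {2}(size l) (leqnn (size l)) => n.
elim: n l => [|n IH] l; first by case: l.
move=> ln l0.
case: (boolP (all inb l)) => [/allP h|/allPn [y yl yout]].
  rewrite (ball_divdiff_in l0) //.
  by case: eqP => _; rewrite ?abs1 ?abs0; lra.
case: (boolP (has inb l)) => [/hasP [x xl xin]|/hasPn h]; last first.
  by rewrite ball_divdiff_out // abs0; lra.
have e1 := perm_to_rem xl.
have yl' : y \in rem x l.
  move: yl; rewrite (perm_mem e1) inE => /orP [/eqP e|//].
  by rewrite e xin in yout.
have e : perm_eq l (x :: y :: rem y (rem x l)).
  by rewrite (perm_trans e1) // perm_cons perm_to_rem.
set L := rem y _ in e; rewrite (perm_ball_divdiff e).
have xy : (1 <= abs (x - y))%Re.
  apply: Rnot_lt_le => h; move/inbP: yout; apply.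
  have -> : y - 1 = (x - 1) + (y - x) by rewrite [RHS]addrC addrA subrK.
  apply: Rle_lt_trans (absU _ _) _; apply: Rmax_lub_lt; first exact/inbP.
  by rewrite absB.
have b z : (abs (ball_divdiff (z :: L)) <= 1)%Re.
  by apply: IH => //; move: ln; rewrite (perm_size e).
have := ball_divdiff_cons x y L; rewrite /GRing.scale /= => E.
have := absM (x - y) (ball_divdiff (x :: y :: L)); rewrite -E => E2.
have : (abs (ball_divdiff (x :: L) - ball_divdiff (y :: L)) <= 1)%Re.
  by apply: Rle_trans (absU _ _) _; rewrite absN; apply: Rmax_lub.
have aux (a u v : R) : (1 <= a -> 0 <= u -> v = a * u -> v <= 1 -> u <= 1)%Re by nra.
exact: aux xy (abs_ge0 _) E2.
Qed.

Lemma ultrametric_bump : exists D, bump D.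
Proof.
exists ball_divdiff; split; [|split; [|split]].
- rewrite ball_divdiff_in // => x; rewrite inE => /eqP ->; apply/inbP.
  by rewrite subrr abs0; lra.
- exact: ball_divdiff_divided_differences.
- by exists (fun _ => 1%Re) => l; apply: ball_divdiff_bound.
(* A point of the ball |x - 1| < 1 has |x| = 1, which lies strictly between 1/2 and 2. *)
- move=> l lP; apply: ball_divdiff_out => x /lP xP; apply/inbP => h.
  have h1 : (abs x <= Rmax (abs (x - 1)) 1)%Re.
    by have := absU (x - 1) 1; rewrite subrK abs1.
  have h2 : (1 <= Rmax (abs x) (abs (x - 1)))%Re.
    by have := absU x (1 - x); rewrite addrCA subrr addr0 abs1 (absB 1 x).
  have aux (a b : R) : (b < 1 -> a <= Rmax b 1 -> 1 <= Rmax a b ->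
      a <= 1/2 \/ 2 <= a -> False)%Re.
    by rewrite /Rmax; do 2![case: Rle_dec => ?] => ? ? ? [] ?; lra.
  exact: aux h h1 h2 xP.
Qed.

End Ultrametric.
End AbsoluteValue.

(** * Pointwise continuity and product topologies *)

Section Continuity.
Variables (T1 T2 : Type).
Variables (op1 : (T1 -> Prop) -> Prop) (op2 : (T2 -> Prop) -> Prop).

Definition cont (f : T1 -> T2) : Prop :=
  forall x W, op2 W -> W (f x) -> exists O, op1 O /\ O x /\ forall y, O y -> W (f y).

Lemma continuous_map_cont f : continuous_map op1 op2 f -> cont f.
Proof. by move=> cf x W oW Wx; exists (fun x => W (f x)); split; first exact: cf. Qed.

Lemma cont_cst c : is_topology op1 -> cont (fun=> c).
Proof. by move=> [oT _] x W _ Wc; exists (fun=> True). Qed.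

Lemma prod_open_topology :
  is_topology op1 -> is_topology op2 -> is_topology (prod_open op1 op2).
Proof.
move=> [T_1 [U_1 I_1]] [T_2 [U_2 I_2]]; split; [|split].
- by move=> p _; exists (fun=> True), (fun=> True).
- move=> F oF p [O [FO Op]]; have [A [B [oA [oB [Ap [Bp AB]]]]]] := oF _ FO _ Op.
  by exists A, B; do !split=> //; move=> q Aq Bq; exists O; split=> //; apply: AB.
- move=> P Q oP oQ p [Pp Qp].
  have [A [B [oA [oB [Ap [Bp AB]]]]]] := oP _ Pp.
  have [C [D [oC [oD [Cp [Dp CD]]]]]] := oQ _ Qp.
  exists (fun x => A x /\ C x), (fun x => B x /\ D x).
  split; [exact: I_1|split; [exact: I_2|do !split=> //]].
    by apply: AB; tauto.
  by apply: CD; tauto.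
Qed.

End Continuity.

Lemma cont_comp (T1 T2 T3 : Type) op1 op2 op3 (f : T1 -> T2) (g : T2 -> T3) :
  cont op1 op2 f -> cont op2 op3 g -> cont op1 op3 (fun x => g (f x)).
Proof.
move=> cf cg x W oW Wx; have [O [oO [Ox OW]]] := cg _ _ oW Wx.
have [P [oP [Px PO]]] := cf _ _ oO Ox; exists P; do !split=> //.
by move=> y Py; apply/OW/PO.
Qed.

Lemma cont_pair (T T1 T2 : Type) op op1 op2 (f : T -> T1) (g : T -> T2) :
  is_topology op -> cont op op1 f -> cont op op2 g ->
  cont op (prod_open op1 op2) (fun x => (f x, g x)).
Proof.
move=> [_ [_ oI]] cf cg x W oW Wx; have [A [B [oA [oB [Ax [Bx AB]]]]]] := oW _ Wx.
have [P [oP [Px PA]]] := cf _ _ oA Ax.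
have [Q [oQ [Qx QB]]] := cg _ _ oB Bx.
exists (fun y => P y /\ Q y); do !split=> //; first exact: oI.
by move=> y [Py Qy]; apply: AB; [apply: PA|apply: QB].
Qed.

Lemma cont_fst (T1 T2 : Type) op1 op2 :
  @is_topology T2 op2 -> cont (prod_open op1 op2) op1 (@fst T1 T2).
Proof.
move=> [oT _] x W oW Wx; exists (fun p => W p.1); do !split=> //.
by move=> p Wp; exists W, (fun=> True).
Qed.

Lemma cont_snd (T1 T2 : Type) op1 op2 :
  @is_topology T1 op1 -> cont (prod_open op1 op2) op2 (@snd T1 T2).
Proof.
move=> [oT _] x W oW Wx; exists (fun p => W p.2); do !split=> //.
by move=> p Wp; exists (fun=> True), W.
Qed.

(** * Calculus of C^k maps defined on whole spaces *)

Section Smoothness.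
Import GRing.Theory.
Local Open Scope ring_scope.
Variables (K : fieldType) (abs : K -> R).
Hypothesis absP : is_absval abs.

Lemma openK_topology : is_topology (openK abs).
Proof.
split; [|split].
- by move=> x _; exists 1%Re; split=> //; lra.
- move=> F oF x [A [FA Ax]]; have [r [r0 h]] := oF _ FA _ Ax.
  by exists r; split=> // y /h Ay; exists A.
- move=> A B oA oB x [Ax Bx].
  have [r [r0 hr]] := oA _ Ax; have [s [s0 hs]] := oB _ Bx.
  exists (Rmin r s); split; first exact: Rmin_pos.
  move=> y hy; split; [apply: hr|apply: hs]; apply: Rlt_le_trans hy _.
    exact: Rmin_l.
  exact: Rmin_r.
Qed.

Lemma openK_ball x r : openK abs (fun y => (abs (y - x) < r)%Re).
Proof.
move=> y hy; exists (r - abs (y - x))%Re; split; first lra.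
move=> z /Rplus_lt_compat_r hz; have -> : z - x = (z - y) + (y - x) by rewrite addrA subrK.
apply: Rle_lt_trans (absD absP _ _) _.
by have := hz (abs (y - x)); rewrite /Rminus Rplus_assoc Rplus_opp_l Rplus_0_r.
Qed.

Lemma regular_tvs : is_tvs abs (E := K^o) (openK abs).
Proof.
split; first exact: openK_topology.
split=> W oW [x y] /= Wxy; have [r [r0 h]] := oW _ Wxy.
  have r2 : (0 < r / 2)%Re by lra.
  exists (fun z => (abs (z - x) < r / 2)%Re), (fun z => (abs (z - y) < r / 2)%Re).
  rewrite /= !subrr abs0 //; do !split=> //; try exact: openK_ball.
  move=> [x' y'] /= hx hy; apply: h; rewrite opprD addrACA.
  apply: Rle_lt_trans (absD absP _ _) _.
  by rewrite (double_var r); apply: Rplus_lt_compat.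
(* For u, v < s <= 1 the error u v + |x| v + u |y| is below s (1 + |x| + |y|) <= r. *)
pose s := Rmin 1 (r / (1 + abs x + abs y)).
have ax := abs_ge0 absP x; have ay := abs_ge0 absP y.
have s0 : (0 < s)%Re.
  by apply: Rmin_pos; [lra|apply: Rdiv_lt_0_compat; lra].
exists (fun z => (abs (z - x) < s)%Re), (fun z => (abs (z - y) < s)%Re).
rewrite /= !subrr abs0 //; do !split=> //; try exact: openK_ball.
move=> [x' y'] /= hx hy; apply: h; rewrite /GRing.scale /=.
have -> : x' * y' - x * y = (x' - x) * (y' - y) + (x * (y' - y) + (x' - x) * y).
  by rewrite addrA -mulrDl subrK mulrBr mulrBl addrA subrK.
apply: Rle_lt_trans (absD absP _ _) _.
apply: Rle_lt_trans (Rplus_le_compat_l _ _ _ (absD absP _ _)) _.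
rewrite !(absM absP).
have s1 : (s <= 1)%Re by apply: Rmin_l.
have sr : (s * (1 + abs x + abs y) <= r)%Re.
  apply: Rle_trans (Rmult_le_compat_r _ _ _ _ (Rmin_r _ _)) _; first lra.
  by apply: Req_le; field; lra.
have := abs_ge0 absP (x' - x); have := abs_ge0 absP (y' - y).
move: (abs (x' - x)) (abs (y' - y)) hx hy => u v hx hy v0 u0.
nra.
Qed.

Section Tvs.
Variables (Y : lmodType K) (opY : (Y -> Prop) -> Prop).
Hypothesis tvsY : is_tvs abs opY.

Lemma tvs_topology : is_topology opY.
Proof. by case: tvsY. Qed.

Lemma tvs_add a b W : opY W -> W (a + b) ->
  exists A B, opY A /\ opY B /\ A a /\ B b /\ forall x y, A x -> B y -> W (x + y).
Proof.
case: tvsY => _ [cA _] oW Wab.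
have [A [B [oA [oB [Aa [Bb AB]]]]]] := cA W oW (a, b) Wab.
by exists A, B; do !split=> //; move=> x y Ax By; apply: (AB (x, y)).
Qed.

Lemma tvs_scale a b W : opY W -> W (a *: b) ->
  exists r B, (0 < r)%Re /\ opY B /\ B b /\
    forall x y, (abs (x - a) < r)%Re -> B y -> W (x *: y).
Proof.
case: tvsY => _ [_ cS] oW Wab.
have [A [B [oA [oB [Aa [Bb AB]]]]]] := cS W oW (a, b) Wab.
have [r [r0 hr]] := oA _ Aa.
by exists r, B; do !split=> //; move=> x y /hr Ax By; apply: (AB (x, y)).
Qed.

Lemma tvs_half W : opY W -> W 0 ->
  exists V, opY V /\ V 0 /\ forall x y, V x -> V y -> W (x + y).
Proof.
move=> oW W0; have [|A [B [oA [oB [A0 [B0 AB]]]]]] := tvs_add (a := 0) (b := 0) oW.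
  by rewrite addr0.
exists (fun x => A x /\ B x); split; first by case: tvs_topology => _ [_]; apply.
by split=> // x y [Ax _] [_ By]; apply: AB.
Qed.

Lemma cont_add X opX (f g : X -> Y) : is_topology opX ->
  cont opX opY f -> cont opX opY g -> cont opX opY (fun x => f x + g x).
Proof.
move=> tX cf cg; apply: (cont_comp (g := fun p : Y * Y => p.1 + p.2) (cont_pair tX cf cg)).
by apply: continuous_map_cont; case: tvsY => _ [].
Qed.

Lemma cont_scale X opX (w : X -> K) (g : X -> Y) : is_topology opX ->
  cont opX (openK abs) w -> cont opX opY g -> cont opX opY (fun x => w x *: g x).
Proof.
move=> tX cw cg; apply: (cont_comp (g := fun p : K * Y => p.1 *: p.2) (cont_pair tX cw cg)).
by apply: continuous_map_cont; case: tvsY => _ [].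
Qed.

Definition open1 (X : lmodType K) (opX : (X -> Prop) -> Prop)
  : (X * X * K^o -> Prop) -> Prop :=
  prod_open (prod_open opX opX) (openK abs : (K^o -> Prop) -> Prop).

Lemma open1_topology X opX : is_topology opX -> is_topology (@open1 X opX).
Proof.
move=> tX; apply: prod_open_topology openK_topology.
exact: prod_open_topology.
Qed.

Lemma cont_base X opX : is_topology opX -> cont (@open1 X opX) opX (fun p => p.1.1).
Proof.
by move=> tX; exact: cont_comp (cont_fst openK_topology) (cont_fst tX).
Qed.

Lemma cont_direction X opX : is_topology opX -> cont (@open1 X opX) opX (fun p => p.1.2).
Proof.
by move=> tX; exact: cont_comp (cont_fst openK_topology) (cont_snd tX).
Qed.

(** The global counterpart of [Ck]: difference quotient maps live on the whole space, so the domains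
    [V1 V] disappear until [CkT_Ck] restores them. *)
Fixpoint CkT (k : nat) (X : lmodType K) (opX : (X -> Prop) -> Prop) (g : X -> Y)
  {struct k} : Prop :=
  cont opX opY g /\
  match k with
  | 0 => True
  | k'.+1 => exists g1 : X * X * K^o -> Y,
      (forall p, g (p.1.1 + p.2 *: p.1.2) - g p.1.1 = p.2 *: g1 p) /\
      CkT k' (open1 opX) g1
  end.

Lemma CkT_cont k X opX g : @CkT k X opX g -> cont opX opY g.
Proof. by case: k => [|k] []. Qed.

Lemma CkT_Ck k X opX g V : @CkT k X opX g -> Ck abs opY k opX V g.
Proof.
elim: k X opX g V => [|k IH] X opX g V [cg Hg]; split.
- by move=> x _ W oW Wx; have [O [oO [Ox OW]]] := cg _ _ oW Wx; exists O; do !split; auto.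
- by [].
- by move=> x _ W oW Wx; have [O [oO [Ox OW]]] := cg _ _ oW Wx; exists O; do !split; auto.
- by have [g1 [h1 h2]] := Hg; exists g1; split=> //; apply: IH.
Qed.

Lemma CkTW k X opX g : @CkT k.+1 X opX g -> CkT k opX g.
Proof.
elim: k X opX g => [|k IH] X opX g [cg [g1 [h1 h2]]]; split=> //.
by exists g1; split=> //; apply: IH.
Qed.

(** The difference quotient map of g o L is g1 o (L x L x id), and L x L x id is again linear and
    continuous. *)
Lemma CkT_comp k (X : lmodType K) opX (X' : lmodType K) opX' (L : X' -> X) g :
  is_topology opX' ->
  cont opX' opX L -> (forall x t v, L (x + t *: v) = L x + t *: L v) ->
  CkT k opX g -> @CkT k X' opX' (fun x => g (L x)).
Proof.
elim: k X opX X' opX' L g => [|k IH] X opX X' opX' L g tX cL lL [cg Hg].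
  by split=> //; apply: cont_comp cL cg.
split; first exact: cont_comp cL cg.
have [g1 [h1 h2]] := Hg.
pose L1 (p : X' * X' * K^o) : X * X * K^o := (L p.1.1, L p.1.2, p.2).
exists (fun p => g1 (L1 p)); split; first by move=> p; rewrite lL; apply: (h1 (L1 p)).
have tXX := prod_open_topology tX tX.
apply: (IH _ _ _ _ L1) h2; first exact: open1_topology.
  apply: cont_pair; first exact: open1_topology.
    apply: cont_pair; first exact: open1_topology.
      exact: cont_comp (cont_base tX) cL.
    exact: cont_comp (cont_direction tX) cL.
  exact: cont_snd.
by move=> [[x v] t] s [[x' v'] t']; rewrite /L1 /= !lL.
Qed.

Lemma CkT_fst k X opX g : is_topology opX -> @CkT k X opX g ->
  CkT k (open1 opX) (fun p => g p.1.1).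
Proof.
move=> tX; apply: (CkT_comp (L := fun p : X * X * K^o => p.1.1)) => //.
  exact: open1_topology.
exact: cont_base.
Qed.

Lemma CkT_linear k (X : lmodType K) opX (L : X -> Y) : is_topology opX ->
  cont opX opY L -> (forall x t v, L (x + t *: v) = L x + t *: L v) ->
  CkT k opX L.
Proof.
elim: k X opX L => [|k IH] X opX L tX cL lL; split=> //.
exists (fun p => L p.1.2); split; first by move=> p; rewrite lL addrC addKr.
apply: IH; first exact: open1_topology.
  exact: cont_comp (cont_direction tX) cL.
by move=> [[x v] t] s [[x' v'] t']; apply: lL.
Qed.

Lemma CkT_cst k X opX (c : Y) : is_topology opX -> @CkT k X opX (fun=> c).
Proof.
elim: k X opX c => [|k IH] X opX c tX; split=> //; try exact: cont_cst.
exists (fun=> 0); split; first by move=> p; rewrite subrr scaler0.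
exact/IH/open1_topology.
Qed.

Lemma CkT_add k X opX f g : is_topology opX ->
  @CkT k X opX f -> CkT k opX g -> CkT k opX (fun x => f x + g x).
Proof.
elim: k X opX f g => [|k IH] X opX f g tX [cf Hf] [cg Hg]; split=> //; try exact: cont_add.
have [f1 [f1E f1C]] := Hf; have [g1 [g1E g1C]] := Hg.
exists (fun p => f1 p + g1 p); split; last by apply: IH => //; apply: open1_topology.
by move=> p; rewrite opprD addrACA f1E g1E scalerDr.
Qed.
End Tvs.

Lemma CkT_scale (Y : lmodType K) opY k (X : lmodType K) opX (w : X -> K^o) (g : X -> Y) :
  @is_tvs K abs Y opY -> is_topology opX ->
  CkT (Y := K^o) (openK abs) k opX w -> CkT opY k opX g -> CkT opY k opX (fun x => w x *: g x).
Proof.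
move=> tY.
elim: k X opX w g => [|k IH] X opX w g tX Cw Cg.
  by split=> //; apply: cont_scale (CkT_cont Cw) (CkT_cont Cg).
split; first by apply: cont_scale (CkT_cont Cw) (CkT_cont Cg).
have Cw' := CkTW Cw; have Cg' := CkTW Cg.
have [_ [w1 [w1E w1C]]] := Cw; have [_ [g1 [g1E g1C]]] := Cg.
have tX1 := open1_topology tX.
(* The product rule. The shifted value g(x + t v) is written as g(x) + t g1, since (x, v, t) |-> x +
   t v is not linear and [CkT_comp] does not cover it. *)
exists (fun p => w1 p *: (g p.1.1 + (p.2 : K^o) *: g1 p) + w p.1.1 *: g1 p); split.
  move=> p.
  have gE : g p.1.1 + p.2 *: g1 p = g (p.1.1 + p.2 *: p.1.2) by rewrite -g1E addrC subrK.
  rewrite gE scalerDr !scalerA [p.2 * w p.1.1]mulrC -[_ *: g1 p]scalerA -g1E.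
  by rewrite -[p.2 * w1 p]/(p.2 *: w1 p) -w1E scalerBl scalerBr addrA subrK.
have tp : CkT (Y := K^o) (openK abs) k (open1 opX) (fun p : X * X * K^o => p.2).
  apply: CkT_linear => //; apply: cont_snd; exact: prod_open_topology.
apply: CkT_add => //; apply: (IH) => //; last exact: CkT_fst.
apply: CkT_add => //; first exact: CkT_fst.
exact: IH.
Qed.

(** * Bounded divided differences are smooth *)

Section DividedDifferences.
Variables (E : lmodType K) (opE : (E -> Prop) -> Prop) (D : seq K -> E).
Hypothesis tvsE : is_tvs abs opE.
Hypothesis Ddd : divided_differences D.

(** For each m > 0 the values of D on lists of length m form a bounded set in the sense of
    topological vector spaces. *)
Definition bounded_by_size : Prop :=
  forall m W, opE W -> W 0 -> exists2 r, (0 < r)%Re &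
    forall a l, (abs a < r)%Re -> (0 < m)%N -> size l = m -> W (a *: D l).

Hypothesis Dbdd : bounded_by_size.

(** Arguments are moved one at a time; each move costs (q x - q x0) times a value of D, small by
    boundedness. The free prefix l holds the arguments already moved. *)
Lemma cont_divided_differences_aux X opX (qs : seq (X -> K)) x0 m W :
  is_topology opX -> List.Forall (cont opX (openK abs)) qs -> opE W -> W 0 ->
  exists O, opX O /\ O x0 /\ forall x l, O x -> size l = m ->
    W (D (l ++ map (fun q => q x) qs) - D (l ++ map (fun q => q x0) qs)).
Proof.
move=> tX cqs; elim: cqs m W => [|q {}qs cq _ IH] m W oW W0.
  by exists (fun=> True); split; [case: tX|split=> // x l _ _; rewrite subrr].
have [V [oV [V0 VW]]] := tvs_half tvsE oW W0.
have [O [oO [Ox OV]]] := IH m.+1 V oV V0.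
(* The list consists of the m entries of l, both [q x] and [q x0], and the remaining arguments. *)
have [r r0 hr] := Dbdd (m + (size qs).+2)%N oV V0.
have := cq x0 _ (@openK_ball (q x0) r); rewrite subrr (abs0 absP).
move=> /(_ r0) [P [oP [Px PB]]].
exists (fun x => O x /\ P x); split; first by case: tX => _ [_]; apply.
split=> // x l [Ox' Px'] sl; rewrite /=.
set s := map _ qs; set s0 := map _ qs.
have -> : D (l ++ q x :: s) - D (l ++ q x0 :: s0) =
  (D (rcons l (q x) ++ s) - D (rcons l (q x) ++ s0)) +
  (q x - q x0) *: D (l ++ q x :: q x0 :: s0).
  by rewrite -Ddd -!cats1 -!catA /= addrA subrK.
apply: VW; first by apply: OV => //; rewrite size_rcons sl.
apply: hr; first exact: PB.
  by rewrite addnS.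
by rewrite size_cat /= sl size_map.
Qed.

Lemma cont_divided_differences X opX (qs : seq (X -> K)) :
  is_topology opX -> List.Forall (cont opX (openK abs)) qs ->
  cont opX opE (fun x => D (map (fun q => q x) qs)).
Proof.
move=> tX cqs x0 W oW Wx.
have [|A [B [oA [oB [A0 [Bx AB]]]]]] :=
  tvs_add tvsE (a := 0) (b := D (map (fun q => q x0) qs)) oW; first by rewrite add0r.
have [O [oO [Ox OA]]] := cont_divided_differences_aux x0 0 tX cqs oA A0.
exists O; do !split=> //; move=> x Ox'.
rewrite -[D _](subrK (D (map (fun q => q x0) qs))); apply: AB => //.
exact: (OA x [::]).
Qed.

(** Arbitrary argument functions are allowed because the difference quotient map is a sum of
    products of scalar maps with maps of the same form on longer lists; induction on k then
    closes. *)
Lemma CkT_divided_differences k (X : lmodType K) opX (qs : seq (X -> K^o)) :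
  is_topology opX -> List.Forall (CkT (Y := K^o) (openK abs) k opX) qs ->
  CkT opE k opX (fun x => D (map (fun q => q x) qs)).
Proof.
elim: k X opX qs => [|k IHk] X opX qs tX Cqs.
  split=> //; apply: cont_divided_differences => //.
  by apply: List.Forall_impl Cqs => q [].
split.
  apply: cont_divided_differences => //.
  by apply: List.Forall_impl Cqs => q [].
have tX1 := open1_topology tX.
have tp : CkT (Y := K^o) (openK abs) k (open1 opX) (fun p : X * X * K^o => p.2).
  by apply: CkT_linear => //; apply: cont_snd; exact: prod_open_topology.
(* Telescoping: the arguments are shifted one at a time, from the left. *)
have step (rs : seq (X * X * K^o -> K^o)) :
    List.Forall (CkT (Y := K^o) (openK abs) k (open1 opX)) rs ->
    exists g1 : X * X * K^o -> E, CkT opE k (open1 opX) g1 /\ forall p,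
      D (map (fun q => q p) rs ++ map (fun q => q (p.1.1 + p.2 *: p.1.2)) qs)
      - D (map (fun q => q p) rs ++ map (fun q => q p.1.1) qs) = p.2 *: g1 p.
  elim: Cqs rs => [|q {}qs Cq Cqs IH] rs Crs.
    exists (fun=> 0); split; first exact: CkT_cst.
    by move=> p; rewrite subrr scaler0.
  have [_ [q1 [q1E q1C]]] := Cq.
  pose q' (p : X * X * K^o) : K^o := q p.1.1 + p.2 *: q1 p.
  have q'E p : q (p.1.1 + p.2 *: p.1.2) = q' p by rewrite /q' -q1E [RHS]addrC subrK.
  have q0C := CkT_fst tX (CkTW Cq).
  have tK := regular_tvs.
  have q'C : CkT (Y := K^o) (openK abs) k (open1 opX) q'.
    by apply: CkT_add => //; apply: CkT_scale.
  have [|g1 [g1C g1E]] := IH (rcons rs q').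
    by rewrite -cats1; apply/List.Forall_app; split=> //; constructor.
  pose ss := rs ++ q' :: (fun p => q p.1.1) :: map (fun q p => q p.1.1) qs.
  exists (fun p => g1 p + q1 p *: D (map (fun q => q p) ss)); split.
    apply: CkT_add => //; apply: CkT_scale => //; apply: IHk => //.
    apply/List.Forall_app; split=> //; constructor=> //; constructor=> //.
    elim: Cqs => [|s {}ss Cs _ IHs] /=; constructor=> //.
    exact: (CkT_fst tX (CkTW Cs)).
  move=> p; rewrite scalerDr -g1E scalerA -[p.2 * q1 p]/(p.2 *: q1 p) -q1E q'E.
  rewrite /ss map_cat /= -map_comp -Ddd map_rcons -!cats1 -!catA /=.
  by rewrite addrA subrK q'E.
have [|g1 [g1C g1E]] := step [::]; first by constructor.
by exists g1; split.
Qed.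

Lemma divided_differences_smooth x0 : smooth_curve abs opE (fun x => x0 + D [:: x]).
Proof.
have tK := openK_topology.
move=> k; apply/CkT_Ck/CkT_add => //; first exact: CkT_cst.
apply: (CkT_divided_differences (X := K^o) (qs := [:: id])) => //.
constructor=> //; apply: CkT_linear => //.
by move=> x W oW Wx; exists W.
Qed.
End DividedDifferences.
End Smoothness.

(** * Bumps rescaled by powers of rho *)

Section ScaledBumps.
Import GRing.Theory.
Local Open Scope ring_scope.
Variables (K : fieldType) (abs : K -> R).
Hypothesis absP : is_absval abs.
Variables (D : seq K -> K^o) (rho : K).
Hypothesis Dbump : bump abs D.
Hypothesis rho2 : (2 <= abs rho)%Re.

Lemma rho_neq0 : rho != 0.
Proof. by apply/eqP => e; move: rho2; rewrite e (abs0 absP); lra. Qed.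

Lemma abs_rho_pow_ge n : (INR n <= abs (rho ^+ n))%Re.
Proof.
rewrite (absX absP); elim: n => [|n IH]; first by rewrite /=; lra.
rewrite S_INR /=.
have h : (1 <= abs rho ^ n)%Re by apply: pow_R1_Rle; lra.
by move: (abs rho ^ n)%Re h IH => u h IH; move: (abs rho) rho2 => v hv; nra.
Qed.

Lemma exists_rho_pow_gt (M : R) : exists N, forall n, (N <= n)%N -> (M < abs (rho ^+ n))%Re.
Proof.
have [N hN] := INR_unbounded M; exists N => n /leP Nn.
apply: Rlt_le_trans (abs_rho_pow_ge n); apply: Rlt_le_trans (le_INR _ _ Nn); exact: hN.
Qed.

(* The divided differences of x |-> h (rho^n x), where h x = D [:: x]. *)
Definition scaled_bump (n : nat) (l : seq K) : K^o :=
  (rho ^+ n) ^+ (size l).-1 * D (map (fun x => rho ^+ n * x) l).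

Lemma scaled_bump_divided_differences n : divided_differences (scaled_bump n).
Proof.
move=> l1 x' x l2; have [_ [Ddd _]] := Dbump.
rewrite /scaled_bump !size_cat /= !addnS /= !map_cat /= -mulrBr Ddd -mulrBr exprS.
rewrite /GRing.scale /= -!mulrA [LHS]mulrCA [RHS]mulrCA; congr (_ * _).
by rewrite [RHS]mulrCA.
Qed.

(** Rescaling multiplies the bound by a power of |rho^n|; this growth in n dictates how fast x_n
    must approach x0. *)
Lemma scaled_bump_bound : exists C : nat -> nat -> R,
  forall n l, (0 < size l)%N -> (abs (scaled_bump n l) <= C n (size l))%Re.
Proof.
have [_ [_ [[B DB] _]]] := Dbump.
exists (fun n m => abs ((rho ^+ n) ^+ m.-1) * B m)%Re => n l l0.
rewrite (absM absP); apply: Rmult_le_compat_l; first exact: abs_ge0.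
by rewrite -(size_map (fun x => rho ^+ n * x) l); apply: DB; rewrite size_map.
Qed.

(** For large n, rho^n moves every nonzero node beyond absolute value 2, while the node 0 stays
    inside the shell's hole. *)
Lemma scaled_bump_eventually0 l :
  exists N, forall n, (N <= n)%N -> scaled_bump n l = 0.
Proof.
have [_ [_ [_ D0]]] := Dbump.
have [N hN] : exists N, forall n, (N <= n)%N -> forall x, x \in l ->
    (abs (rho ^+ n * x) <= 1/2)%Re \/ (2 <= abs (rho ^+ n * x))%Re.
  elim: l => [|x l [N IH]]; first by exists 0%N.
  have [x0|x0] := eqVneq x 0.
    exists N => n Nn y; rewrite inE => /orP [/eqP ->|]; last exact: IH.
    by left; rewrite x0 mulr0 (abs0 absP); lra.
  have [P hP] := exists_rho_pow_gt (2 / abs x).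
  exists (maxn N P) => n; rewrite geq_max => /andP [Nn Pn] y.
  rewrite inE => /orP [/eqP ->|]; last exact: IH.
  right; rewrite (absM absP); have a0 := abs_gt0 absP x0.
  have -> : 2%Re = (2 / abs x * abs x)%Re by field; lra.
  by apply: Rmult_le_compat_r; [lra|apply/Rlt_le/hP].
exists N => n Nn; rewrite /scaled_bump D0 ?mulr0 // => y /mapP [x xl ->].
exact: hN.
Qed.

Lemma scaled_bump0 n : scaled_bump n [:: 0] = 0.
Proof.
have [_ [_ [_ D0]]] := Dbump; rewrite /scaled_bump /= mulr0 D0 ?mulr0 // => x.
by rewrite inE => /eqP ->; left; rewrite (abs0 absP); lra.
Qed.

(** The bump is evaluated at rho^(k-n), which is 1 for k = n and otherwise has absolute value at
    most 1/2 or at least 2. *)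
Lemma scaled_bumpV k n : scaled_bump k [:: (rho ^+ n)^-1] = (k == n)%:R.
Proof.
have [D1 [_ [_ D0]]] := Dbump.
have rn m : rho ^+ m != 0 by rewrite expf_neq0 // rho_neq0.
have big m : (2 <= abs (rho ^+ m.+1))%Re.
  rewrite (absX absP) /=.
  have h : (1 <= abs rho ^ m)%Re by apply: pow_R1_Rle; lra.
  by move: (abs rho ^ m)%Re h => u h; move: (abs rho) rho2 => v hv; nra.
rewrite /scaled_bump /= expr0 mul1r.
case: (ltngtP k n) => [kn|nk|->]; last by rewrite divff.
- rewrite D0 // => x; rewrite inE => /eqP ->; left.
  rewrite -(subnKC kn) addSnnS exprD invfM mulrA divff // mul1r (absV absP) //.
  by apply: Rle_trans (Rinv_le_contravar _ _ _ (big _)) _; lra.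
- rewrite D0 // => x; rewrite inE => /eqP ->; right.
  by rewrite -(subnKC nk) addSnnS exprD [_ * rho ^+ _]mulrC mulfK.
Qed.
End ScaledBumps.

(** * Series of bumps with rapidly decreasing coefficients *)

Section Series.
Import GRing.Theory.
Local Open Scope ring_scope.
Variables (K : fieldType) (abs : K -> R).
Hypothesis absP : is_absval abs.
Variables (E : lmodType K) (opE : (E -> Prop) -> Prop).
Hypothesis tvsE : is_tvs abs opE.

(** Write a v = (a/c)(c v) with a fixed c so large that |a/c| < r; then only continuity of v |-> c v
    at 0 restricts v. *)
Lemma tvs_absorb M W : opE W -> W 0 -> exists O, opE O /\ O 0 /\
  forall a v, (abs a <= M)%Re -> O v -> W (a *: v).
Proof.
move=> oW W0.
have [|r [B [r0 [oB [B0 rB]]]]] := tvs_scale tvsE (a := 0) (b := 0) oW.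
  by rewrite scale0r.
have [rho rho2] := exists_abs_ge2 absP.
have [N hN] := exists_rho_pow_gt absP rho2 (M / r).
set c := rho ^+ N.
have c0 : c != 0 by rewrite expf_neq0 // (rho_neq0 absP rho2).
have [|s [O [s0 [oO [O0 sO]]]]] := tvs_scale tvsE (a := c) (b := 0) oB.
  by rewrite scaler0.
exists O; do !split=> //; move=> a v aM Ov.
have -> : a *: v = (a / c) *: (c *: v) by rewrite scalerA divfK.
apply: rB; last by apply: sO => //; rewrite subrr (abs0 absP).
have cM : (M / r < abs c)%Re := hN N (leqnn N).
have ac := abs_gt0 absP c0.
rewrite subr0 (absM absP) (absV absP) //.
apply: (Rmult_lt_reg_r (abs c)) => //.
rewrite Rmult_assoc Rinv_l ?Rmult_1_r; last lra.
apply: Rle_lt_trans aM _.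
have -> : M = (r * (M / r))%Re by field; lra.
exact: Rmult_lt_compat_l.
Qed.

(** Each set is obtained by halving its predecessor and intersecting with the metric ball of radius
    1/(n+1) around 0. *)
Lemma tvs_base V : metrizable opE -> opE V -> V 0 ->
  exists W : nat -> E -> Prop, [/\ forall x, W 0%N x -> V x,
    forall n, opE (W n), forall n, W n 0,
    forall n x y, W n.+1 x -> W n.+1 y -> W n (x + y) &
    forall O, opE O -> O 0 -> exists n, forall x, W n x -> O x].
Proof.
move=> [d [d_ge0 [d_eq0 [d_sym [d_tri dE]]]]] oV V0.
pose T := {W : E -> Prop | opE W /\ W 0}.
pose B n x := Rlt (d 0 x) (/ INR n.+1)%Re.
have oB n : opE (B n).
  apply/dE => x Bx; exists (Rminus (/ INR n.+1)%Re (d 0 x)); rewrite /B in Bx *; split; first lra.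
  by move=> y h; have := d_tri 0 x y; lra.
have B0 n : B n 0.
  rewrite /B (proj2 (d_eq0 0 0) erefl); apply: Rinv_0_lt_compat.
  by apply: lt_0_INR; apply/ltP.
have step (n : nat) (W : T) : {W' : T |
    (forall x y, sval W' x -> sval W' y -> sval W (x + y)) /\
    (forall x, sval W' x -> B n x)}.
  apply: constructive_indefinite_description; case: W => W [oW W0] /=.
  have [O [oO [O0 OW]]] := tvs_half tvsE oW W0.
  have h : opE (fun x => O x /\ B n x) /\ (O 0 /\ B n 0).
    by split; [case: (tvs_topology tvsE) => _ [_]; apply|split].
  exists (exist _ (fun x => O x /\ B n x) h) => /=; split; last by move=> x [].
  by move=> x y [Ox _] [Oy _]; apply: OW.
pose W := fix W n : T := if n is n'.+1 then sval (step n' (W n')) else exist _ V (conj oV V0).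
exists (fun n => sval (W n)); split=> //.
- by move=> n; case: (W n) => ? [].
- by move=> n; case: (W n) => ? [].
- by move=> n x y /=; case: (step n (W n)) => ? [] h _ /=; apply: h.
- move=> O oO O0; have [r [r0 hr]] := proj1 (dE O) oO _ O0.
  have [N hN] := INR_unbounded (/ r).
  exists N.+1 => x /=; case: (step N (W N)) => ? [] _ h /= /h Bx.
  apply: hr; apply: Rlt_trans Bx _.
  rewrite -(Rinv_inv r); apply: Rinv_lt_contravar.
    by apply: Rmult_lt_0_compat; [apply: Rinv_0_lt_compat|apply: lt_0_INR; apply/ltP].
  by apply: Rlt_trans hN _; apply: lt_INR; apply/ltP.
Qed.

Section Sum.
Variables (H : nat -> seq K -> K^o) (C : nat -> nat -> R) (v : nat -> E)
  (W : nat -> E -> Prop).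
Hypothesis Hdd : forall n, divided_differences (H n).
Hypothesis HC : forall n l, (0 < size l)%N -> (abs (H n l) <= C n (size l))%Re.
Hypothesis H0 : forall l, exists N, forall n, (N <= n)%N -> H n l = 0.
Hypothesis W0 : forall n, W n 0.
Hypothesis WD : forall n x y, W n.+1 x -> W n.+1 y -> W n (x + y).
Hypothesis Wbase : forall O, opE O -> O 0 -> exists n, forall x, W n x -> O x.
(** On lists of length m this controls all terms with n >= m - 1, leaving finitely many to be
    treated separately. *)
Hypothesis Hv : forall n l a, (0 < size l)%N -> (size l <= n.+1)%N ->
  (abs a <= 1)%Re -> W n.+1 (a *: (H n l *: v n)).

Let bound (l : seq K) : nat := sval (constructive_indefinite_description _ (H0 l)).

(* The series is a finite sum at each list, so no completeness of E is needed. *)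
Definition bump_series (l : seq K) : E := \sum_(0 <= n < bound l) H n l *: v n.

Lemma bump_seriesE l N : (forall n, (N <= n)%N -> H n l = 0) ->
  bump_series l = \sum_(0 <= n < N) H n l *: v n.
Proof.
move=> hN; rewrite /bump_series.
have hb : forall n, (bound l <= n)%N -> H n l = 0.
  by rewrite /bound; case: constructive_indefinite_description.
have gen M P : (M <= P)%N -> (forall n, (M <= n)%N -> H n l = 0) ->
    \sum_(0 <= n < P) H n l *: v n = \sum_(0 <= n < M) H n l *: v n.
  move=> MP hM; rewrite (big_cat_nat (leq0n M) MP) /= -[RHS]addr0; congr (_ + _).
  rewrite big_nat_cond big1 // => n /andP [/andP [Mn _] _].
  by rewrite hM // scale0r.
by rewrite -(gen _ _ (leq_maxl (bound l) N) hb) (gen _ _ (leq_maxr (bound l) N) hN).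
Qed.

Lemma bump_series_divided_differences : divided_differences bump_series.
Proof.
move=> l1 x' x l2.
have [N1 h1] := H0 (l1 ++ x' :: l2); have [N2 h2] := H0 (l1 ++ x :: l2).
have [N3 h3] := H0 (l1 ++ x' :: x :: l2).
pose N := maxn N1 (maxn N2 N3).
have N1N : (N1 <= N)%N by rewrite leq_maxl.
have N2N : (N2 <= N)%N by rewrite leq_max leq_maxl orbT.
have N3N : (N3 <= N)%N by rewrite leq_max leq_maxr orbT.
rewrite (bump_seriesE (N := N)) => [|n /(leq_trans N1N)]; last exact: h1.
rewrite (bump_seriesE (N := N)) => [|n /(leq_trans N2N)]; last exact: h2.
rewrite (bump_seriesE (N := N)) => [|n /(leq_trans N3N)]; last exact: h3.
rewrite -sumrB scaler_sumr; apply: eq_bigr => n _.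
by rewrite -scalerBl Hdd scalerA.
Qed.

Lemma W_decr m n x : (m <= n)%N -> W n x -> W m x.
Proof.
move=> /subnKC <-; elim: (n - m)%N => [|k IH]; first by rewrite addn0.
by rewrite addnS => h; apply: IH; rewrite -[x]addr0; apply: WD.
Qed.

(** Repeated use of [WD] from the first term onwards; the result does not depend on the number of
    terms. *)
Lemma W_sum (u : nat -> E) m n : (forall k, (m <= k)%N -> W k.+1 (u k)) ->
  W m (\sum_(m <= k < n) u k).
Proof.
move=> hu; case: (leqP m n) => [mn|nm]; last by rewrite big_geq // ltnW.
rewrite -(subnKC mn); move: (n - m)%N {mn} => j; elim: j m hu => [|j IH] m hu.
  by rewrite addn0 big_geq.
rewrite addnS big_ltn ?ltnS ?leq_addr //; apply: WD; first exact: hu.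
by rewrite -addSn; apply: IH => k mk; apply: hu; apply: ltnW.
Qed.

Lemma bump_series_in x : W 0%N (bump_series [:: x]).
Proof.
apply: W_sum => k _; rewrite -[_ *: v k]scale1r; apply: Hv => //.
by rewrite (abs1 absP); lra.
Qed.

Lemma bump_series_bounded : bounded_by_size abs opE bump_series.
Proof.
move=> m O oO O0.
have [V [oV [V0 VO]]] := tvs_half tvsE oO O0.
have [n0 hn0] := Wbase oV V0.
(* From n1 on, lists of length m satisfy the size condition of [Hv], and the tail falls into W n0,
   hence into V. The head has a fixed number of terms and is made small by a alone. *)
pose n1 := maxn n0 m.
have head n V' : opE V' -> V' 0 -> exists2 r, (0 < r)%Re & forall a l, (abs a < r)%Re ->
    (0 < m)%N -> size l = m -> V' (a *: \sum_(0 <= k < n) H k l *: v k).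
  elim: n V' => [|n IH] V' oV' V'0.
    by exists 1%Re; [lra|move=> a l _ _ _; rewrite big_geq // scaler0].
  have [P [oP [P0 PV]]] := tvs_half tvsE oV' V'0.
  have [r r0 hr] := IH _ oP P0.
  have [|s [B [s0 [oB [Bv sB]]]]] := tvs_scale tvsE (a := 0) (b := v n) oP.
    by rewrite scale0r.
  have c0 := Rabs_pos (C n m).
  exists (Rmin r (s / (Rabs (C n m) + 1))).
    by apply: Rmin_pos => //; apply: Rdiv_lt_0_compat; lra.
  move=> a l ar m0 sl; rewrite big_nat_recr //= scalerDr; apply: PV.
    by apply: hr => //; apply: Rlt_le_trans ar _; apply: Rmin_l.
  rewrite scalerA; apply: sB => //; rewrite subr0 (absM absP).
  have hb : (abs (H n l) <= Rabs (C n m) + 1)%Re.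
    have : (abs (H n l) <= C n m)%Re by rewrite -sl; apply: HC; rewrite sl.
    by have := Rle_abs (C n m); lra.
  have ha : (abs a < s / (Rabs (C n m) + 1))%Re by apply: Rlt_le_trans ar _; apply: Rmin_r.
  apply: Rle_lt_trans (Rmult_le_compat_l _ _ _ (abs_ge0 absP a) hb) _.
  have -> : s = (s / (Rabs (C n m) + 1) * (Rabs (C n m) + 1))%Re by field; lra.
  by apply: Rmult_lt_compat_r => //; lra.
have [r r0 hr] := head n1 V oV V0.
exists (Rmin r 1); first by apply: Rmin_pos => //; lra.
move=> a l ar m0 sl.
have ar1 : (abs a < r)%Re by apply: Rlt_le_trans ar _; apply: Rmin_l.
have a1 : (abs a <= 1)%Re by apply: Rlt_le; apply: Rlt_le_trans ar _; apply: Rmin_r.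
have [N hN] := H0 l.
rewrite (bump_seriesE (N := maxn n1 N)); last first.
  by move=> n; rewrite geq_max => /andP [_]; apply: hN.
rewrite (big_cat_nat (leq0n n1) (leq_maxl n1 N)) /= scalerDr; apply: VO; first exact: hr.
apply: hn0; apply: (W_decr (leq_maxl n0 m)); rewrite scaler_sumr.
apply: W_sum => k nk; apply: Hv => //; rewrite sl //.
by apply: leqW; apply: leq_trans nk; apply: leq_maxr.
Qed.
End Sum.
End Series.

(** * Smooth interpolation of a sequence and the final topology *)

Section SpecialCurve.
Import GRing.Theory.
Local Open Scope ring_scope.
Variables (K : fieldType) (abs : K -> R) (E : lmodType K) (opE : (E -> Prop) -> Prop).
Hypothesis absA : admissible_field abs.
Hypothesis tvsE : is_tvs abs opE.
Hypothesis metE : metrizable opE.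

Lemma admissible_bump : exists D, bump abs D.
Proof.
case: absA => absP [reals|ultra]; first exact: usual_reals_bump.
exact: ultrametric_bump.
Qed.

(** The O n encode the required speed of convergence and, like the times t n = rho^-n, are fixed
    before the points x n are chosen. *)
Lemma special_curve (U : E -> Prop) (x0 : E) : opE U -> U x0 ->
  exists (O : nat -> E -> Prop) (t : nat -> K),
    [/\ forall n, opE (O n) /\ O n x0,
        forall r, (0 < r)%Re -> exists n, (abs (t n) < r)%Re &
        forall x : nat -> E, (forall n, O n (x n)) ->
        exists c, [/\ smooth_curve abs opE c, forall s, U (c s), c 0 = x0
          & forall n, c (t n) = x n]].
Proof.
move=> oU Ux0; have absP : is_absval abs by case: absA.
have [D Dbump] := admissible_bump; have [rho rho2] := exists_abs_ge2 absP.
have [|A0 [V [_ [oV [A0x [V0 AV]]]]]] := tvs_add tvsE (a := x0) (b := 0) oU.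
  by rewrite addr0.
have [W [WV oW W0 WD Wbase]] := tvs_base tvsE metE oV V0.
have [C HC] := scaled_bump_bound absP rho Dbump.
(* The n-th term has to be controlled only on lists of length at most n+1, so one bound M n suffices
   to define O n. *)
have Mex n : exists M, forall m, (m <= n.+1)%N -> (C n m <= M)%Re.
  elim: n.+1 => [|k [M IH]].
    by exists (C n 0%N) => m; rewrite leqn0 => /eqP ->; apply: Rle_refl.
  exists (Rmax M (C n k.+1)) => m; rewrite leq_eqVlt => /orP [/eqP ->|mk].
    exact: Rmax_r.
  by apply: Rle_trans (IH _ _) (Rmax_l _ _).
pose M n := sval (constructive_indefinite_description _ (Mex n)).
have MC n m : (m <= n.+1)%N -> (C n m <= M n)%Re.
  by rewrite /M; case: constructive_indefinite_description => y; apply.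
have Oex n : exists O, (opE O /\ O x0) /\
    forall y, O y -> forall a, (abs a <= M n)%Re -> W n.+1 (a *: (y - x0)).
  have [P [oP [P0 PW]]] := tvs_absorb absP tvsE (M n) (oW n.+1) (W0 n.+1).
  have [|A [B [oA [_ [Ax [Bx AB]]]]]] := tvs_add tvsE (a := x0) (b := - x0) oP.
    by rewrite subrr.
  by exists A; split=> // y Ay a aM; apply: PW => //; apply: AB.
pose O n := sval (constructive_indefinite_description _ (Oex n)).
have OP n : (opE (O n) /\ O n x0) /\
    forall y, O n y -> forall a, (abs a <= M n)%Re -> W n.+1 (a *: (y - x0)).
  by rewrite /O; case: constructive_indefinite_description.
exists O, (fun n => (rho ^+ n)^-1); split; first by move=> n; case: (OP n).
  move=> r r0; have [N hN] := exists_rho_pow_gt absP rho2 (/ r).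
  exists N; rewrite (absV absP) ?expf_neq0 ?(rho_neq0 absP rho2) //.
  rewrite -(Rinv_inv r); apply: Rinv_lt_contravar; last exact: hN.
  have r0' := Rinv_0_lt_compat _ r0.
  by apply: Rmult_lt_0_compat => //; apply: Rlt_trans (hN N (leqnn N)).
move=> x Ox; pose v n := x n - x0; pose H := scaled_bump D rho.
have Hdd n : divided_differences (H n) by apply: (scaled_bump_divided_differences rho Dbump).
have H0 l : exists N, forall n, (N <= n)%N -> H n l = 0.
  exact: (scaled_bump_eventually0 absP Dbump rho2).
have Hv n l a : (0 < size l)%N -> (size l <= n.+1)%N -> (abs a <= 1)%Re ->
    W n.+1 (a *: (H n l *: v n)).
  move=> l0 ln a1; rewrite scalerA; apply: (proj2 (OP n)) => //.
  rewrite (absM absP); apply: Rle_trans (MC n _ ln); rewrite -[C _ _]Rmult_1_l.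
  by apply: Rmult_le_compat (HC _ _ l0) => //; apply: abs_ge0.
exists (fun s => x0 + bump_series v H0 [:: s]); split.
- apply: divided_differences_smooth => //.
    exact: bump_series_divided_differences.
  exact: (bump_series_bounded absP tvsE HC _ W0 WD Wbase Hv).
- by move=> s; apply: AV => //; apply: WV; apply: (bump_series_in absP).
- rewrite (bump_seriesE _ _ (N := 0%N)) ?big_geq ?addr0 // => n _.
  exact: (scaled_bump0 absP rho Dbump).
- move=> n; have HV k : H k [:: (rho ^+ n)^-1] = (k == n)%:R.
    exact: (scaled_bumpV absP Dbump rho2).
  rewrite (bump_seriesE _ _ (N := n.+1)) => [|k nk]; last by rewrite HV gtn_eqF.
  rewrite big_nat_recr //= HV eqxx scale1r big_nat_cond big1 ?add0r ?subrKC //.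
  by move=> k /andP [/andP [_ kn] _]; rewrite HV ltn_eqF // scale0r.
Qed.

Lemma smooth_curve_cont c : smooth_curve abs opE c -> cont (openK abs) opE c.
Proof.
move=> /(_ 0%N) [cc _] x W oW Wx; have [O [oO [Ox OW]]] := cc x I W oW Wx.
by exists O; do !split=> //; move=> y Oy; apply: OW.
Qed.

Lemma final_topology_smooth_curves (U : E -> Prop) (A : {x : E | U x} -> Prop) : opE U ->
  (exists O, opE O /\ forall x, A x <-> O (sval x)) <->
  (forall (c : K -> E) (Hc : forall t, U (c t)), smooth_curve abs opE c ->
     openK abs (fun t => A (exist _ (c t) (Hc t)))).
Proof.
move=> oU; split=> [[O [oO AO]] c Hc sc s /AO Oc|HA].
  have [P [oP [Ps PO]]] := smooth_curve_cont sc oO Oc.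
  have [r [r0 hr]] := oP _ Ps; exists r; split=> // y /hr Py.
  by apply/AO; apply: PO.
have irr x (h h' : U x) : A (exist _ x h) -> A (exist _ x h').
  by rewrite (proof_irrelevance _ h h').
(* A itself, viewed in E, is shown to be open in E, which is possible because U is open. *)
exists (fun x => exists h : U x, A (exist _ x h)); split; last first.
  move=> [x h] /=; split=> [Ax|[h' Ax]]; first by exists h.
  exact: irr Ax.
have [d dP] := metE; have dE := proj2 (proj2 (proj2 (proj2 dP))).
apply/dE => x0 [h0 A0]; apply: NNPP => not_open.
have [O [t [OP t0 curve]]] := special_curve oU h0.
(* Otherwise O n, which contains a metric ball around x0, would show that x0 is an interior
   point. *)
have xex n : exists x, O n x /\ ~ exists h : U x, A (exist _ x h).
  apply: NNPP => no; apply: not_open; have [oO Ox0] := OP n.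
  have [r [r0 hr]] := proj1 (dE _) oO _ Ox0; exists r; split=> // y /hr Oy.
  by apply: NNPP => nAy; apply: no; exists y.
pose x n := sval (constructive_indefinite_description _ (xex n)).
have xP n : O n (x n) /\ ~ exists h : U (x n), A (exist _ (x n) h).
  by rewrite /x; case: constructive_indefinite_description.
have [c [sc Uc c0 cx]] := curve x (fun n => proj1 (xP n)).
have Ac0 : A (exist _ (c 0) (Uc 0)).
  by move: (Uc 0); rewrite c0 => h; apply: irr A0.
have [r [r0 hr]] := HA c Uc sc 0 Ac0.
have [n tn] := t0 r r0.
apply: (proj2 (xP n)); rewrite -cx; exists (Uc (t n)); apply: hr.
by rewrite subr0.
Qed.
End SpecialCurve.

Local Open Scope ring_scope.

Theorem theorem11p3 (K : fieldType) (abs : K -> R) (E : lmodType K)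
  (opE : (E -> Prop) -> Prop) (U : E -> Prop) :
  admissible_field abs ->
  is_tvs abs opE -> hausdorff opE -> metrizable opE ->
  opE U -> (exists x, U x) ->
  (* (a) induced topology on U = final topology w.r.t. smooth curves into U *)
  (forall A : {x : E | U x} -> Prop,
     (exists O, opE O /\ forall x, A x <-> O (sval x)) <->
     (forall (c : K -> E) (Hc : forall t, U (c t)), smooth_curve abs opE c ->
        openK abs (fun t => A (exist _ (c t) (Hc t))))) /\
  (* (b) continuity test along smooth curves *)
  (forall (Z : Type) (opZ : (Z -> Prop) -> Prop) (f : {x : E | U x} -> Z),
     is_topology opZ ->
     ((forall W, opZ W -> exists O, opE O /\ forall x, W (f x) <-> O (sval x)) <->
      (forall (c : K -> E) (Hc : forall t, U (c t)), smooth_curve abs opE c ->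
         continuous_map (openK abs) opZ (fun t => f (exist _ (c t) (Hc t)))))).
Proof.
move=> absA tvsE _ metE oU _.
have a A := final_topology_smooth_curves absA tvsE metE A oU.
(* Statement (b) is (a) applied to the preimages under f of open sets of Z. *)
split=> // Z opZ f _; split=> [Hf c Hc sc W oW | Hf W oW].
  exact: (proj1 (a (fun x => W (f x))) (Hf W oW)).
by apply/(a (fun x => W (f x))) => c Hc sc; apply: Hf.
Qed.
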